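(* Let $k$ be a commutative ring and let $\mathcal{D}$ be a nonempty small category. Then $\mathcal{D}$ is dimension zero over $k$ if and only if the following three conditions all hold: $k$ is Artinian; each hom-set $\operatorname{Hom}_{\mathcal{D}}(x,y)$ (for $x,y\in\mathcal{D}$) is finite; and $\mathcal{D}$ admits a homological modulus over $k$.
   Context: A representation of $\mathcal{D}$ over $k$ is a functor $V:\mathcal{D}\to \mathrm{Mod}_k$ to the category of $k$-modules; maps of representations are natural transformations, and kernels and images are formed objectwise. A representation $V$ is generated in degrees $\{d_i\}_{i\in I}$, for a collection of objects $d_i\in\mathcal{D}$, if any subrepresentation $W\subseteq V$ with $W(d_i)=V(d_i)$ for all $i\in I$ has $W=V$. A representation $V$ is finitely generated if it is generated in degrees $\{d_1,\dots,d_l\}$ for some finite list of objects and each $V(d_i)$ is finitely generated as a $k$-module. (Concretely, if $V$ is finitely generated, then there are finitely many $v_i\in V(d_i)$ spanning $V$ using scalars from $k$ and arrows from $\mathcal{D}$.) $V$ has finite length if it satisfies both the ascending and the descending chain conditions on subrepresentations. A nonempty category $\mathcal{D}$ is dimension zero over $k$ if all its finitely generated representations have finite length. For objects $x,y\in\mathcal{D}$, let $S(x,y)$ be the set of morphisms $x\to x$ that factor through $y$. For an object $d\in\mathcal{D}$ and $s\in S(x,y)$, let $M_s$ be the square $0$-$1$ matrix with rows and columns indexed by $\operatorname{Hom}_{\mathcal{D}}(d,x)$, whose entry in position $(f,g)$ is $1$ if $s\circ f=g$ and $0$ otherwise. Write $x\leq_d y$ if the identity matrix (indexed by $\operatorname{Hom}_{\mathcal{D}}(d,x)$)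 lies in the $k$-span of the matrices $M_s$, $s\in S(x,y)$. A homological modulus for $\mathcal{D}$ over $k$ is a function $\mu$ from $\operatorname{Ob}(\mathcal{D})$ to the finite subsets of $\operatorname{Ob}(\mathcal{D})$ such that for every $d,x\in\mathcal{D}$ there exists $y\in\mu(d)$ with $x\leq_d y$.
   Formalization: Here k is nonzero, and ''finitely generated'' means that finitely many v_i span V using scalars and arrows, not that each V(d_i) is finitely generated over k; otherwise an infinite group over a field, or the zero ring with infinite hom-sets, is a counterexample. *)

(* Defs.v *)
From HB Require Import structures.
From mathcomp Require Import all_boot all_order all_algebra.
From mathcomp Require Import boolp classical_sets functions cardinality.

Set Implicit Arguments.
Unset Strict Implicit.
Unset Printing Implicit Defensive.

Import GRing.Theory.
Local Open Scope classical_set_scope.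
Local Open Scope ring_scope.

Section LinearAlgebra.
Context (k : comNzRingType) (M : lmodType k).

Definition lin_span (A : set M) : set M :=
  [set v | exists (n : nat) (c : 'I_n -> k) (s : 'I_n -> M),
     (forall i, A (s i)) /\ v = \sum_(i < n) c i *: s i].

Definition fg_module : Prop :=
  exists (n : nat) (s : 'I_n -> M), lin_span (range s) = setT.

Definition dcc_module : Prop :=
  forall W : nat -> set M,
    (forall n, submod_closed (mem (W n))) ->
    (forall n, W n.+1 `<=` W n) ->
    exists N, forall n, (N <= n)%N -> W n = W N.

End LinearAlgebra.

(* The ideals of k are the submodules of the regular module k^o. *)
Definition artinian_ring (k : comNzRingType) : Prop := dcc_module k^o.

Record smallCategory := SmallCategory {
  Ob :> Type;
  Mor : Ob -> Ob -> Type;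
  idm : forall x, Mor x x;
  compm : forall x y z, Mor y z -> Mor x y -> Mor x z;
  compm_idl : forall x y (f : Mor x y), compm (idm y) f = f;
  compm_idr : forall x y (f : Mor x y), compm f (idm x) = f;
  compm_assoc : forall x y z t (h : Mor z t) (g : Mor y z) (f : Mor x y),
    compm h (compm g f) = compm (compm h g) f
}.

Arguments Mor {s}.
Arguments idm {s}.
Arguments compm {s x y z}.

Section Representations.
Context (k : comNzRingType) (D : smallCategory).

Record representation := Representation {
  rep_ob :> D -> lmodType k;
  rep_map : forall x y, Mor x y -> {linear rep_ob x -> rep_ob y};
  rep_map_id : forall x (v : rep_ob x), rep_map (idm x) v = v;
  rep_map_comp : forall x y z (g : Mor y z) (f : Mor x y) (v : rep_ob x),
    rep_map (compm g f) v = rep_map g (rep_map f v)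
}.

Context (V : representation).

Definition subrepresentation (W : forall x, set (V x)) : Prop :=
  (forall x, submod_closed (mem (W x))) /\
  (forall x y (f : Mor x y) (v : V x), W x v -> W y (rep_map V f v)).

Definition generated_in_degrees (I : Type) (d : I -> D) : Prop :=
  forall W : forall x, set (V x), subrepresentation W ->
    (forall i, W (d i) = setT) -> forall x, W x = setT.

(* Finitely many v_i in V(d_i) span V using scalars and arrows.  When the
   hom-sets are finite, this says that V is generated in finitely many degrees
   d_i with every V(d_i) a finitely generated k-module (lemmas
   finitely_generated_degrees and degrees_finitely_generated below).  For
   infinite hom-sets the latter is stronger and is not the intended notion: it
   fails for the free representation on a generator in degree d as soon as
   Mor d d is infinite. *)
Definition finitely_generated : Prop :=
  exists (l : nat) (d : 'I_l -> D) (v : forall i, V (d i)),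
    forall x, lin_span [set w : V x | exists (i : 'I_l) (f : Mor (d i) x),
                          w = rep_map V f (v i)] = setT.

Definition rep_acc : Prop :=
  forall W : nat -> forall x, set (V x),
    (forall n, subrepresentation (W n)) ->
    (forall n x, W n x `<=` W n.+1 x) ->
    exists N, forall n, (N <= n)%N -> forall x, W n x = W N x.

Definition rep_dcc : Prop :=
  forall W : nat -> forall x, set (V x),
    (forall n, subrepresentation (W n)) ->
    (forall n x, W n.+1 x `<=` W n x) ->
    exists N, forall n, (N <= n)%N -> forall x, W n x = W N x.

Definition finite_length : Prop := rep_acc /\ rep_dcc.

End Representations.

(* Nonemptiness of D is a separate hypothesis wherever this is used. *)
Definition dimension_zero (k : comNzRingType) (D : smallCategory) : Prop :=
  forall V : representation k D, finitely_generated V -> finite_length V.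

Section HomologicalModulus.
Context (k : comNzRingType) (D : smallCategory).

Definition factors_through (x y : D) : set (Mor x x) :=
  [set s | exists (a : Mor x y) (b : Mor y x), s = compm b a].
Arguments factors_through : clear implicits.

(* Square matrices over k with rows and columns indexed by Mor d x, which may
   be infinite; the k-module structure is entrywise. *)
Definition hom_matrix (d x : D) : lmodType k := Mor d x -> Mor d x -> k^o.

Definition hom_matrix1 (d x : D) : hom_matrix d x :=
  fun f g => (`[< f = g >])%:R.
Arguments hom_matrix1 : clear implicits.

Definition postcomp_matrix (d x : D) (s : Mor x x) : hom_matrix d x :=
  fun f g => (`[< compm s f = g >])%:R.
Arguments postcomp_matrix : clear implicits.

Definition le_at (d x y : D) : Prop :=
  lin_span (postcomp_matrix d x @` factors_through x y) (hom_matrix1 d x).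

Definition homological_modulus (mu : D -> set D) : Prop :=
  (forall d, finite_set (mu d)) /\
  (forall d x, exists2 y, mu d y & le_at d x y).

End HomologicalModulus.

Arguments factors_through {D} x y _.
Arguments hom_matrix1 k {D} d x _ _.
Arguments postcomp_matrix k {D} d x s _ _.

Section LinSpanTheory.
Context (k : comNzRingType) (M : lmodType k).

Lemma lin_span_sub (A B : set M) :
  submod_closed (mem B) -> A `<=` B -> lin_span A `<=` B.
Proof.
move=> [B0 BD] AB v [n [c [s [As ->]]]]; apply/set_mem.
elim/big_ind: _ => // [u w Bu Bw|i _].
- by rewrite -[u]scale1r; apply: BD.
- by rewrite -[_ *: _]addr0; apply: BD => //; apply/mem_set/AB/As.
Qed.

Lemma sub_lin_span (A : set M) : A `<=` lin_span A.
Proof.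
move=> v Av; exists 1%N, (fun=> 1), (fun=> v); split=> //.
by rewrite big_ord1 scale1r.
Qed.

Lemma lin_span_submod (A : set M) : submod_closed (mem (lin_span A)).
Proof.
split; first by apply/mem_set; exists 0%N, (fun=> 0), (fun=> 0);
  split=> [[]//|]; rewrite big_ord0.
move=> a u v /set_mem [m [c [s [As ->]]]] /set_mem [n [e [t [At ->]]]].
apply/mem_set; exists (m + n)%N,
  (fun i => match fintype.split i with inl j => a * c j | inr j => e j end),
  (fun i => match fintype.split i with inl j => s j | inr j => t j end); split.
  by move=> i; case: (fintype.split i).
rewrite big_split_ord scaler_sumr /=; congr (_ + _); apply: eq_bigr => i _.
- by rewrite (unsplitK (inl i)) scalerA.
- by rewrite (unsplitK (inr i)).
Qed.

End LinSpanTheory.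

Section FiniteGeneration.
Context (k : comNzRingType) (D : smallCategory) (V : representation k D).

Lemma degrees_finitely_generated (l : nat) (d : 'I_l -> D) :
  generated_in_degrees V d -> (forall i, fg_module (V (d i))) ->
  finitely_generated V.
Proof.
move=> gen fg.
pose n i := projT1 (cid (fg i)).
pose s i : 'I_(n i) -> V (d i) := projT1 (cid (projT2 (cid (fg i)))).
have span_s i : lin_span (range (s i)) = setT.
  exact: (projT2 (cid (projT2 (cid (fg i))))).
pose J := {i : 'I_l & 'I_(n i)}.
pose tj (j : 'I_#|{: J}|) : J := enum_val j.
exists #|{: J}|, (fun j => d (tag (tj j))), (fun j => s _ (tagged (tj j))).
apply: gen => [|i].
  split=> [x|x y f v]; first exact: lin_span_submod.
  move=> [m [c [w [Aw ->]]]]; exists m, c, (fun i => rep_map V f (w i)).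
  split=> [i|]; last by rewrite linear_sum; apply: eq_bigr => i _; rewrite linearZ.
  have [j [g ->]] := Aw i; exists j, (compm f g).
  by rewrite rep_map_comp.
apply/seteqP; split=> // v _.
have: lin_span (range (s i)) v by rewrite span_s.
apply: lin_span_sub; first exact: lin_span_submod.
move=> _ [p _ <-]; apply: sub_lin_span.
exists (enum_rank (Tagged (fun i => 'I_(n i)) p : J)).
by rewrite /tj enum_rankK /=; exists (idm _); rewrite rep_map_id.
Qed.

Lemma finitely_generated_degrees :
  (forall x y : D, finite_set [set: Mor x y]) -> finitely_generated V ->
  exists (l : nat) (d : 'I_l -> D),
    generated_in_degrees V d /\ forall i, fg_module (V (d i)).
Proof.
move=> finD [l [d [v gen]]]; exists l, d; split=> [W [Wsub Wmap] WT x|i].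
  apply/seteqP; split=> // w _.
  have: lin_span [set w : V x | exists i (f : Mor (d i) x),
    w = rep_map V f (v i)] w by rewrite gen.
  by apply: lin_span_sub => // _ [i [f ->]]; apply: Wmap; rewrite WT.
have fin_gens : finite_set [set w : V (d i) | exists j (f : Mor (d j) (d i)),
    w = rep_map V f (v j)].
  have -> : [set w : V (d i) | exists j (f : Mor (d j) (d i)),
      w = rep_map V f (v j)] =
      \bigcup_(j in [set: 'I_l]) range (fun f : Mor (d j) (d i) =>
        rep_map V f (v j)).
    apply/seteqP; split=> [w [j [f ->]]|w [j _ [f _ <-]]].
      by exists j => //; exists f.
    by exists j, f.
  by apply: bigcup_finite => [|j _]; [exact: finite_finset|exact: finite_image].
have /finite_seqP [r rE] := fin_gens.
exists (size r), (fun p => nth 0 r p).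
rewrite -(gen (d i)); congr lin_span; rewrite rE.
apply/seteqP; split=> [w [p _ <-]|w /= wr]; first exact: mem_nth.
have p_lt : (index w r < size r)%N by rewrite index_mem.
by exists (Ordinal p_lt) => //=; rewrite nth_index.
Qed.

End FiniteGeneration.

(* Main.v *)
Require Import Defs.
From HB Require Import structures.
From mathcomp Require Import all_boot all_order all_algebra.
From mathcomp Require Import boolp classical_sets functions cardinality.
From mathcomp.multinomials Require Import freeg.

Set Implicit Arguments.
Unset Strict Implicit.
Unset Printing Implicit Defensive.

Import GRing.Theory.
Local Open Scope classical_set_scope.
Local Open Scope ring_scope.

(** Write [P_d] for the representation [x |-> k[Mor d x]], generated by the
    identity of [d], and [A] for the algebra [k[Mor x x]] of an object [x].

    Suppose that [D] has dimension zero, so that every [P_d] has finite length.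
    The subrepresentations [I P_d], for [I] an ideal of [k], carry the chain
    conditions of [P_d] over to [k].  A submodule of [P_x x] stable under the
    endomorphisms of [x] is the value at [x] of the subrepresentation that it
    generates, hence [A] has finite length as a left module over itself.

    The crux is that this forces the monoid [M = Mor x x] to be finite
    ([multiplicative_basis_finite]).  It suffices that each simple factor [S]
    of [A] be finitely generated over [k].  Among the elements of [M] that do
    not kill [S] take one generating a minimal left ideal; finite length lets
    one replace it by an idempotent [e] ([basis_idempotent]).  By minimality
    the elements of [e M e] that do not kill [S] form a group [G], and [e S] is
    spanned by a single [G]-orbit.  Sending [G] to [1] and the rest of [e M e]
    to [0] is a character of [e A e]; the generator [eps] of its projective
    cover has [eps A] finitely generated over [k], because the character occurs
    at most once in each of the finitely many simple factors of [A]
    ([character_idempotent]).  As [G] translates the support of [eps] freely,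
    [G] is finite, and [e S] is finitely generated.  Finally [S] embeds in a
    finite power of [e S], since the left ideal [A e A] is finitely generated,
    and [k] is noetherian.  Once [Mor x x] is finite, so is [Mor d x], on which
    it acts with finitely many generators.

    For the modulus at [d], colour an object [x] by the set of simple factors
    of [P_d] that do not vanish at [x].  If [x] and [y] have the same colour,
    every vector of a simple factor at [x] can be sent to [y] and back; lifting
    along a composition series, every vector of [P_d x] is fixed by a
    combination of endomorphisms that factor through [y]
    ([colourable_top]), then so are all vectors of a finite basis at once,
    which is the relation between [x] and [y] ([le_atP]).  One object of each
    colour therefore forms a modulus.

    Conversely, let [V] be generated by [v_i] in degree [d_i], [i < l].  A
    chain of subrepresentations becomes stationary at the finitely many objects
    of the [mu (d_i)], where [V] takes finitely generated values and [k] is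
    artinian, hence noetherian ([artinian_noetherian]).  It is then stationary
    everywhere: if [W] is contained in [W'] and both agree at objects [y_i]
    related to [x], let [a_i] be a combination of endomorphisms of [x] through
    [y_i] fixing the images of [v_i].  Then [a_i] maps [W' x] into [W x], so
    [(1 - a_1) ... (1 - a_l)], which kills [V x], is the identity of [W' x]
    modulo [W x] ([subrep_eq_of_le_at]). *)

(** * Chain conditions *)

(** One notion for ascending and descending chains of submodules, left ideals
    or subrepresentations, according to the choice of [le]. *)
Definition stationary (T : Type) (P : set T) (le : T -> T -> Prop) : Prop :=
  forall W : nat -> T, (forall n, P (W n)) -> (forall n, le (W n) (W n.+1)) ->
    exists N, forall n, (N <= n)%N -> W n = W N.

Lemma stationary_maximal (T : Type) (P Q : set T) (le : T -> T -> Prop) :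
  stationary P le -> Q `<=` P -> Q !=set0 ->
  exists2 m, Q m & forall b, Q b -> le m b -> b = m.
Proof.
move=> stP QP [a Qa]; apply: contrapT => nomax.
have next (m : {m | Q m}) : {b : {m | Q m} | le (sval m) (sval b) /\ sval b <> sval m}.
  apply: cid; apply: contrapT => nob; apply: nomax; exists (sval m); first exact: svalP.
  move=> b Qb mb; apply: contrapT => bm.
  by apply: nob; exists (exist _ b Qb).
pose W := fix W n := if n is n'.+1 then sval (next (W n')) else exist _ a Qa.
have [|n|N WN] := stP (fun n => sval (W n)).
- by move=> n; apply/QP/svalP.
- by have [] := svalP (next (W n)).
- by have [_] := svalP (next (W N)); apply; apply: (WN N.+1).
Qed.

(** [F / U] is a simple factor; no quotient is ever formed, and statements
    about a simple module are phrased modulo [U]. *)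
Definition covers (T : Type) (P : set T) (le : T -> T -> Prop) (U F : T) : Prop :=
  [/\ P U, P F, le U F, U <> F &
    forall G, P G -> le U G -> le G F -> G = U \/ G = F].

(** Replaces induction along a composition series: a maximal [U] satisfying [Q]
    is [top], for otherwise a minimal [F] strictly above [U] would cover it. *)
Lemma finite_length_ind (T : Type) (P : set T) (le : T -> T -> Prop)
    (bot top : T) (Q : T -> Prop) :
  stationary P le -> stationary P (fun a b => le b a) ->
  P bot -> P top -> (forall U, P U -> le U top) ->
  Q bot -> (forall U F, covers P le U F -> Q U -> Q F) -> Q top.
Proof.
move=> acc dcc Pbot Ptop letop Qbot step.
have [||m [Pm Qm] maxm] := @stationary_maximal T P [set U | P U /\ Q U] le acc.
- by move=> U [].
- by exists bot.
have [<- //|mtop] := pselect (m = top).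
have [||F [PF mF Fm] minF] :=
  @stationary_maximal T P [set F | [/\ P F, le m F & F <> m]] _ dcc.
- by move=> U [].
- by exists top; split=> //; [apply: letop|move=> /esym].
suff QF : Q F by case: Fm; apply: maxm.
apply: step Qm; split=> // [/esym //|G PG mG GF].
have [->|Gm] := pselect (G = m); first by left.
by right; apply: minF.
Qed.

(** * Modules over a commutative ring *)

Section Submodules.
Context (k : comNzRingType) (M : lmodType k).
Implicit Types (U W : set M) (s : seq M).

Definition submodule : set (set M) := [set U | submod_closed (mem U)].

Lemma submoduleP U : submodule U <->
  U 0 /\ forall a u v, U u -> U v -> U (a *: u + v).
Proof.
split=> [[/set_mem U0 UD]|[U0 UD]]; split=> //.
- by move=> a u v Uu Uv; apply/set_mem/UD; apply/mem_set.
- exact/mem_set.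
- by move=> a u v /set_mem Uu /set_mem Uv; apply/mem_set/UD.
Qed.

Section Closure.
Context (U : set M) (sU : submodule U).
Lemma submodule0 : U 0. Proof. by case/submoduleP: sU. Qed.
Lemma submoduleZ a u : U u -> U (a *: u).
Proof. by move=> Uu; rewrite -[_ *: _]addr0; case/submoduleP: sU => U0; apply. Qed.
Lemma submoduleD u v : U u -> U v -> U (u + v).
Proof. by move=> Uu Uv; rewrite -[u]scale1r; case/submoduleP: sU => _; apply. Qed.
Lemma submoduleN u : U u -> U (- u).
Proof. by rewrite -scaleN1r; apply: submoduleZ. Qed.
Lemma submoduleB u v : U u -> U v -> U (u - v).
Proof. by move=> Uu Uv; apply: submoduleD => //; apply: submoduleN. Qed.
Lemma submodule_sum I (r : seq I) (F : I -> M) :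
  (forall i, U (F i)) -> U (\sum_(i <- r) F i).
Proof.
move=> UF; elim/big_rec: _ => [|i u _ Uu]; first exact: submodule0.
exact: submoduleD.
Qed.
End Closure.

Lemma submoduleI U W : submodule U -> submodule W -> submodule (U `&` W).
Proof.
move=> sU sW; apply/submoduleP; split; first by split; apply: submodule0.
by move=> a u v [Uu Wu] [Uv Wv]; split; apply: submoduleD => //; apply: submoduleZ.
Qed.

Lemma submoduleT : submodule setT.
Proof. exact/submoduleP. Qed.

Lemma submodule_span (B : set M) : submodule (lin_span B).
Proof. exact: lin_span_submod. Qed.

Lemma lin_spanS (A B : set M) : A `<=` B -> lin_span A `<=` lin_span B.
Proof.
move=> AB; apply: lin_span_sub; first exact: lin_span_submod.
by move=> v /AB; apply: sub_lin_span.
Qed.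

Definition sspan s : set M := lin_span [set` s].

Lemma submodule_sspan s : submodule (sspan s).
Proof. exact: submodule_span. Qed.

Lemma sspan_sub s U : submodule U -> (forall x, x \in s -> U x) -> sspan s `<=` U.
Proof. exact: lin_span_sub. Qed.

Lemma mem_sspan s x : x \in s -> sspan s x.
Proof. exact: sub_lin_span. Qed.

Lemma sspanS s t : {subset s <= t} -> sspan s `<=` sspan t.
Proof. by move=> st; apply: lin_spanS. Qed.

Lemma sspan_nil v : sspan [::] v -> v = 0.
Proof.
apply: (@sspan_sub [::] [set 0]) => //; apply/submoduleP; split=> // a u w -> ->.
by rewrite scaler0 addr0.
Qed.

Lemma submodule_line U x : submodule U ->
  submodule [set v | exists c, U (v - c *: x)].
Proof.
move=> sU; apply/submoduleP; split.
  by exists 0; rewrite scale0r subr0; apply: submodule0.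
move=> a u v [c Uc] [d Ud]; exists (a * c + d).
have -> : a *: u + v - (a * c + d) *: x = a *: (u - c *: x) + (v - d *: x).
  by rewrite scalerBr scalerDl opprD scalerA addrACA.
by apply: submoduleD => //; apply: submoduleZ.
Qed.

Lemma sspan_cons x s v : sspan (x :: s) v <-> exists c, sspan s (v - c *: x).
Proof.
split.
  apply: (@sspan_sub (x :: s) [set v | exists c, sspan s (v - c *: x)]).
    exact/submodule_line/submodule_sspan.
  move=> y; rewrite inE => /orP[/eqP ->|ys].
    by exists 1; rewrite scale1r subrr; apply: (submodule0 (submodule_sspan s)).
  by exists 0; rewrite scale0r subr0; apply: mem_sspan.
move=> [c sc]; rewrite -[v](subrK (c *: x)).
apply: (submoduleD (submodule_sspan _)).
  by apply: sspanS sc => y ys; rewrite inE ys orbT.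
by apply/(submoduleZ (submodule_sspan _))/mem_sspan; rewrite inE eqxx.
Qed.

Lemma fg_moduleP : fg_module M <-> exists s, forall v, sspan s v.
Proof.
split=> [[n [s sT]]|[s sT]].
  exists (map s (enum 'I_n)) => v; have : lin_span (range s) v by rewrite sT.
  by apply: lin_spanS => _ [i _ <-] /=; apply/mapP; exists i => //; rewrite mem_enum.
exists (size s), (fun i => nth 0 s i); apply/seteqP; split=> // v _.
apply: lin_spanS (sT v) => x /= xs.
have lts : (index x s < size s)%N by rewrite index_mem.
by exists (Ordinal lts) => //=; rewrite nth_index.
Qed.

End Submodules.

Arguments submodule {k} M.

(** Both chain conditions are treated at once: [up] tells the direction. *)
Definition nested (up : bool) (T : Type) (A B : set T) : Prop :=
  if up then A `<=` B else B `<=` A.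

Lemma nested_le (up : bool) (T : Type) (W : nat -> set T) m n :
  (forall i, nested up (W i) (W i.+1)) -> (m <= n)%N -> nested up (W m) (W n).
Proof.
move=> chW /subnK <-; elim: (n - m)%N => [|d IHd]; first by case: up {chW}.
move: IHd (chW (d + m)%N); rewrite addSn /nested.
by case: up {chW} => [h1 h2|h1 h2] v; [move/h1/h2|move/h2/h1].
Qed.

Section FgChains.
Context (k : comNzRingType) (M : lmodType k).

(** The ideal of the coefficients on [x] of the elements of [W], modulo the span
    of [s]; it plays the part of the image of [W] in a cyclic quotient. *)
Definition lead_ideal (x : M) (s : seq M) (W : set M) : set k^o :=
  [set c : k^o | exists2 w, W w & sspan s (w - c *: x)].

Lemma submodule_lead_ideal x s W : submodule M W -> submodule k^o (lead_ideal x s W).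
Proof.
move=> sW; apply/submoduleP; split.
  exists 0; first exact: submodule0.
  rewrite (_ : 0 - _ = 0); first exact: (submodule0 (submodule_sspan s)).
  by rewrite scale0r subr0.
move=> a c d [u Wu su] [v Wv sv]; exists (a *: u + v).
  by apply: submoduleD => //; apply: submoduleZ.
have -> : a *: u + v - (a *: c + d) *: x = a *: (u - c *: x) + (v - d *: x).
  by rewrite scalerBr scalerDl opprD scalerA addrACA.
have ss := submodule_sspan s.
by apply: submoduleD => //; apply: submoduleZ.
Qed.

Lemma eq_of_lead_ideal x s (W W' : set M) : submodule M W -> submodule M W' ->
  W `<=` W' -> W' `<=` sspan (x :: s) ->
  lead_ideal x s W' `<=` lead_ideal x s W ->
  W' `&` sspan s `<=` W `&` sspan s -> W = W'.
Proof.
move=> sW sW' WW' W's leadW interW; apply/seteqP; split=> // v W'v.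
have /sspan_cons[c vc] := W's _ W'v.
have [|w Ww wc] := leadW c; first by exists v.
rewrite -[v](subrK w); apply: submoduleD => //.
suff [] : (W `&` sspan s) (v - w) by [].
apply: interW; split; first by apply: submoduleB => //; apply: WW'.
have -> : v - w = (v - c *: x) - (w - c *: x) by rewrite opprB addrA subrK.
by apply: submoduleB => //; apply: submodule_sspan.
Qed.

(** Induction on the generators: a submodule is determined, within those that it
    is comparable to, by its intersection with the span of [s] and by its ideal
    of coefficients on [x]. *)
Lemma sspan_stationary up s :
  stationary (submodule k^o) (@nested up _) ->
  stationary [set W | submodule M W /\ W `<=` sspan s] (@nested up _).
Proof.
move=> stk; elim: s => [|x s IHs] W sW chW.
  exists 0%N => n _; have W0 m : W m = [set 0].
    have [sWm Ws] := sW m; apply/seteqP; split=> [v /Ws/sspan_nil //|_ ->].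
    exact: submodule0.
  by rewrite !W0.
have [||N1 W1] := IHs (fun n => W n `&` sspan s).
- move=> n; have [sWn _] := sW n; split; last by move=> v [].
  by apply: submoduleI => //; apply: submodule_sspan.
- move=> n; move: (chW n); rewrite /nested.
  by case: up {stk IHs chW} => Wn v [Wv sv]; split=> //; apply: Wn.
have [||N2 W2] := stk (fun n => lead_ideal x s (W n)).
- by move=> n; apply: submodule_lead_ideal; case: (sW n).
- move=> n; move: (chW n); rewrite /nested.
  by case: up {stk IHs chW} => Wn c [w Ww sw]; exists w => //; apply: Wn.
exists (maxn N1 N2).
move=> n len; move: (nested_le chW len); move: (leq_maxl N1 N2) (leq_maxr N1 N2) len.
move: (maxn N1 N2) => N le1 le2 len; rewrite /nested.
have [sWN WNs] := sW N; have [sWn Wns] := sW n.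
have e1 : W n `&` sspan s = W N `&` sspan s.
  by rewrite (W1 N) // (W1 n) // (leq_trans le1).
have e2 : lead_ideal x s (W n) = lead_ideal x s (W N).
  by rewrite (W2 N) // (W2 n) // (leq_trans le2).
case: up {stk IHs chW} => WW; [apply/esym|]; apply: (@eq_of_lead_ideal x s) => //.
- by rewrite e2.
- by rewrite e1.
- by rewrite e2.
- by rewrite e1.
Qed.

Lemma fg_module_stationary up : fg_module M ->
  stationary (submodule k^o) (@nested up _) ->
  stationary (submodule M) (@nested up _).
Proof.
move=> /fg_moduleP[s sT] /(@sspan_stationary _ s) st W sW; apply: st => n.
by split=> // v _; apply: sT.
Qed.

(** A maximal finitely generated submodule of [U] is [U]. *)
Lemma stationary_fg : stationary (submodule M) (@nested true _) ->
  forall U, submodule M U -> exists s, U = sspan s.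
Proof.
move=> st U sU.
have [||m [s [sU' ->]] maxm] := @stationary_maximal _ (submodule M)
  [set W | exists s, (forall x, x \in s -> U x) /\ W = sspan s] _ st.
- by move=> _ [s [_ ->]]; apply: submodule_sspan.
- by exists (sspan [::]), [::].
exists s; apply/seteqP; split; last exact: sspan_sub.
move=> v Uv; rewrite -(maxm (sspan (v :: s))).
- by apply: mem_sspan; rewrite inE eqxx.
- by exists (v :: s); split=> // x; rewrite inE => /orP[/eqP ->|/sU'].
- by apply: sspanS => x xs; rewrite inE xs orbT.
Qed.

End FgChains.

(** * Commutative artinian rings are noetherian *)

Section Hopkins.
Context (k : comNzRingType).
Implicit Types (I J U : set k^o).

Lemma ideal_mulr_image (c : k) I :
  submodule k^o I -> submodule k^o [set c * x | x in I].
Proof.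
move=> sI; apply/submoduleP; split.
  by exists 0; [exact: submodule0|exact: mulr0].
move=> a _ _ [x Ix <-] [y Iy <-]; exists (a *: x + y).
  by apply: submoduleD => //; apply: submoduleZ.
by rewrite mulrDr; congr (_ + _); rewrite /GRing.scale /= mulrCA.
Qed.

Lemma ideal_mulr_ker (c : k) I :
  submodule k^o I -> submodule k^o [set x | I x /\ c * x = 0].
Proof.
move=> sI; apply/submoduleP; split.
  by split; [exact: submodule0|exact: mulr0].
move=> a x y [Ix cx] [Iy cy]; split.
  by apply: submoduleD => //; apply: submoduleZ.
by rewrite mulrDr cy addr0 /GRing.scale /= mulrCA cx mulr0.
Qed.

Definition noetherian_below I : Prop :=
  stationary [set J | submodule k^o J /\ J `<=` I] (@nested true _).

Lemma noetherian_below0 I : I `<=` [set 0] -> noetherian_below I.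
Proof.
move=> I0 W sW _; exists 0%N => n _; have W0 m : W m = [set 0].
  have [sWm Wm] := sW m; apply/seteqP; split=> [v /Wm/I0 //|_ ->].
  exact: submodule0.
by rewrite !W0.
Qed.

(** Extensions of noetherian modules are noetherian, for the exact sequence of
    multiplication by [c] on [I]. *)
Lemma noetherian_below_image (c : k) I :
  submodule k^o I ->
  noetherian_below [set c * x | x in I] ->
  noetherian_below [set x | I x /\ c * x = 0] -> noetherian_below I.
Proof.
move=> sI accim accker W sW chW.
have chain m n : (m <= n)%N -> W m `<=` W n := nested_le chW.
have [||N1 W1] := accim (fun n => [set c * x | x in W n]).
- move=> n; have [sWn WnI] := sW n; split; first exact: ideal_mulr_image.
  by move=> _ [x /WnI Ix <-]; exists x.
- by move=> n _ [x Wx <-]; exists x => //; apply: chW.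
have [||N2 W2] := accker (fun n => [set x | W n x /\ c * x = 0]).
- move=> n; have [sWn WnI] := sW n; split; first exact: ideal_mulr_ker.
  by move=> x [/WnI Ix cx].
- by move=> n x [Wx cx]; split=> //; apply: chW.
exists (maxn N1 N2) => n; rewrite geq_max => /andP[le1 le2].
set N := maxn N1 N2; have leN : (N <= n)%N by rewrite geq_max le1.
apply/seteqP; split; last exact: chain.
move=> x Wx; have [sWN _] := sW N; have [sWn _] := sW n.
have : [set c * x | x in W N] (c * x).
  by rewrite W1 ?leq_maxl// -(W1 n le1); exists x.
move=> [y Wy cy]; rewrite -[x](subrK y); apply: submoduleD => //.
have [] // : [set x | W N x /\ c * x = 0] (x - y).
rewrite W2 ?leq_maxr// -(W2 n le2); split; last by rewrite mulrBr cy subrr.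
by apply: submoduleB => //; apply: chain Wy.
Qed.

(** The other extension: here [I] is an extension by [U] of a simple module
    generated by [x].  A chain is stationary in [U], and either it stays in [U]
    or one of its members [w] already accounts for the whole quotient. *)
Lemma noetherian_below_hyperplane I U (x : k^o) : submodule k^o U ->
  (forall w, I w -> ~ U w -> exists c, U (x - c *: w)) ->
  (forall w, I w -> exists c, U (w - c *: x)) ->
  noetherian_below U -> noetherian_below I.
Proof.
move=> sU lineU spanU accU W sW chW.
have chain m n : (m <= n)%N -> W m `<=` W n := nested_le chW.
have [||N1 W1] := accU (fun n => W n `&` U).
- move=> n; have [sWn WnI] := sW n; split; last by move=> y [].
  exact: submoduleI.
- by move=> n y [Wy Uy]; split=> //; apply: chW.
have [[N2 [w [Ww nUw]]]|noW] := pselect (exists n w, W n w /\ ~ U w); last first.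
  have WU n : W n = W n `&` U.
    apply/seteqP; split=> [y Wy|y []//]; split=> //; apply: contrapT => nU.
    by apply: noW; exists n, y.
  by exists N1 => n le; rewrite WU (W1 n le) -WU.
exists (maxn N1 N2) => n; rewrite geq_max => /andP[le1 le2].
set N := maxn N1 N2; have leN : (N <= n)%N by rewrite geq_max le1.
apply/seteqP; split; last exact: chain.
move=> y Wy; have [sWN _] := sW N; have [sWn WnI] := sW n.
have [|c Uc] := lineU w _ nUw; first by apply: WnI; apply: chain Ww.
have [d Ud] := spanU y (WnI _ Wy).
have WNw : W N w by apply: chain Ww; apply: leq_maxr.
rewrite -[y](subrK ((d * c) *: w)); apply: submoduleD => //; last exact: submoduleZ.
suff [] : (W N `&` U) (y - (d * c) *: w) by [].
rewrite (W1 N) ?leq_maxl// -(W1 n le1); split.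
  by apply: submoduleB => //; apply: submoduleZ => //; apply: chain WNw.
have -> : y - (d * c) *: w = (y - d *: x) + d *: (x - c *: w).
  by rewrite scalerBr scalerA addrA subrK.
by apply: submoduleD => //; apply: submoduleZ.
Qed.

(** The supremum of an empty chain being empty, Zorn's lemma is applied with
    the empty set thrown in. *)
Lemma exists_maximal_avoiding I (x : k^o) : submodule k^o I -> x != 0 ->
  exists U, [/\ submodule k^o U, U `<=` I, ~ U x &
    forall w, I w -> ~ U w -> exists c, U (x - c *: w)].
Proof.
move=> sI x0.
pose P U := U = set0 \/ [/\ submodule k^o U, U `<=` I & ~ U x].
have [F FP Ftot|U [PU maxU]] := @Zorn_bigcup k^o P.
  have [[U0 FU0 U0n]|allempty] := pselect (exists2 U, F U & U !=set0); last first.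
    left; apply/seteqP; split=> // v [U FU Uv]; apply: allempty.
    by exists U => //; exists v.
  have good U : F U -> U !=set0 -> [/\ submodule k^o U, U `<=` I & ~ U x].
    by move=> FU [v Uv]; have [E|//] := FP _ FU; move: Uv; rewrite E.
  right; split.
  - apply/submoduleP; split.
      by exists U0 => //; have [sU0 _ _] := good _ FU0 U0n; apply: submodule0.
    move=> a u v [A FA Au] [B FB Bv].
    have [AB|BA] := Ftot A B FA FB.
      exists B => //; have [sB _ _] : [/\ submodule k^o B, B `<=` I & ~ B x].
        by apply: good => //; exists v.
      by apply: submoduleD => //; apply: submoduleZ => //; apply: AB.
    exists A => //; have [sA _ _] : [/\ submodule k^o A, A `<=` I & ~ A x].
      by apply: good => //; exists u.
    by apply: submoduleD => //; [apply: submoduleZ|apply: BA].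
  - move=> v [A FA Av]; have [|_ AI _] := good A FA; first by exists v.
    exact: AI.
  - move=> [A FA Ax]; have [|_ _ nAx] := good A FA; first by exists x.
    exact: nAx.
have {PU}[sU UI nUx] : [/\ submodule k^o U, U `<=` I & ~ U x].
  case: PU => [U0|//]; exfalso; apply: (maxU [set 0]).
    rewrite U0; split; first by move=> y //.
    by move/(_ 0) => h; apply: (h erefl).
  right; split.
  - apply/submoduleP; split=> // a u v -> ->; by rewrite scaler0 addr0.
  - by move=> _ ->; apply: submodule0.
  - by move=> xx; move: x0; rewrite xx eqxx.
exists U; split=> // w Iw nUw; apply: contrapT => noc.
apply: (maxU [set v | exists c, U (v - c *: w)]); last first.
  right; split=> //; first exact: submodule_line.
  by move=> v [c Uc]; rewrite -[v](subrK (c *: w)); apply: submoduleD => //;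
    [apply: UI|apply: submoduleZ].
split; first by move=> v Uv; exists 0; rewrite scale0r subr0.
by move=> h; apply: nUw; apply: h; exists 1; rewrite scale1r subrr; apply: submodule0.
Qed.

(** Take [I] minimal among the ideals that are not noetherian.  By the exact
    sequence above each [c] in [k] either kills [I] or maps it onto itself, and
    in the latter case the powers of [c] show that [c] is invertible modulo the
    annihilator of [I].  So [I] is a vector space over a field; it has a
    hyperplane, which is noetherian by minimality, and so is [I]. *)
Lemma artinian_noetherian :
  stationary (submodule k^o) (@nested false _) ->
  stationary (submodule k^o) (@nested true _).
Proof.
move=> dcc; suff : noetherian_below setT.
  by move=> acc W sW; apply: acc => n; split.
apply: contrapT => nacc.
have [||I [sI naccI] minI] := @stationary_maximal _ (submodule k^o)
  [set I | submodule k^o I /\ ~ noetherian_below I] _ dcc.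
- by move=> I [].
- by exists setT; split=> //; apply: submoduleT.
have accI J : submodule k^o J -> J `<=` I -> J <> I -> noetherian_below J.
  by move=> sJ JI nJI; apply: contrapT => nJ; apply/nJI/minI.
have dich c : (forall x, I x -> c * x = 0) \/
    (forall y, I y -> exists2 x, I x & c * x = y).
  have [ker|nker] := pselect ([set x | I x /\ c * x = 0] = I).
    by left=> x; rewrite -{1}ker => -[].
  have [im|nim] := pselect ([set c * x | x in I] = I).
    by right=> y; rewrite -{1}im.
  exfalso; apply: naccI.
  apply: (noetherian_below_image (c := c)) => //; apply: accI => //.
  - exact: ideal_mulr_image.
  - by move=> _ [x Ix <-]; apply: (submoduleZ sI).
  - exact: ideal_mulr_ker.
  - by move=> x [].
have inv c : ~ (forall x, I x -> c * x = 0) ->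
    exists d, forall x, I x -> (1 - d * c) * x = 0.
  move=> nc; have {nc} surj : forall y, I y -> exists2 x, I x & c * x = y.
    by case: (dich c).
  have [||N] := dcc (fun n => [set x : k^o | exists d, x = d * c ^+ n]).
  - move=> n; apply/submoduleP; split; first by exists 0; rewrite mul0r.
    move=> a _ _ [d ->] [e ->]; exists (a * d + e).
    by rewrite mulrDl -mulrA.
  - by move=> n _ [d ->]; exists (d * c); rewrite exprS mulrA.
  move=> /(_ N.+1 (leqnSn _)) E.
  have [d dE] : [set x : k^o | exists d, x = d * c ^+ N.+1] (c ^+ N).
    by rewrite E; exists 1; rewrite mul1r.
  exists d => y Iy; have [x Ix <-] : exists2 x, I x & c ^+ N * x = y.
    elim: (N) y Iy => [|n IHn] y Iy; first by exists y; rewrite ?expr0 ?mul1r.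
    have [z Iz <-] := surj _ Iy; have [x Ix <-] := IHn _ Iz.
    by exists x => //; rewrite exprS mulrA.
  by rewrite mulrA mulrBl mul1r -mulrA -exprS -dE subrr mul0r.
(* A maximal subspace [U] of [I] avoiding a nonzero vector is a hyperplane. *)
have [x Ix x0] : exists2 x, I x & x != 0.
  apply: contrapT => noX; apply/naccI/noetherian_below0 => x Ix.
  by apply: contrapT => /eqP nx; apply: noX; exists x.
have [U [sU UI nUx lineU]] := exists_maximal_avoiding sI x0.
apply/naccI/(noetherian_below_hyperplane sU lineU); last first.
  by apply: accI => // UIE; apply: nUx; rewrite UIE.
move=> w Iw; have [Uw|nUw] := pselect (U w).
  by exists 0; rewrite scale0r subr0.
have [c Uc] := lineU _ Iw nUw.
have nc : ~ (forall x, I x -> c * x = 0).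
  by move=> /(_ w Iw) cw; apply: nUx; move: Uc; rewrite /GRing.scale /= cw subr0.
have [d dc] := inv c nc; exists d.
have -> : w - d *: x = - (d *: (x - c *: w)).
  rewrite scalerBr opprB; congr (_ - _); apply/eqP; rewrite -subr_eq0; apply/eqP.
  by move: (dc w Iw); rewrite mulrBl mul1r -mulrA.
by apply: submoduleN => //; apply: submoduleZ.
Qed.

End Hopkins.

(** * Free modules *)

Lemma submodule_ker (k : comNzRingType) (M N : lmodType k) (f : {linear M -> N}) :
  submodule M [set v | f v = 0].
Proof.
apply/submoduleP; split; first by rewrite /= linear0.
by move=> c u v /= fu fv; rewrite linearP fu fv scaler0 addr0.
Qed.

Section FreeModules.
Context (k : comNzRingType).

Definition free_mod (T : Type) : lmodType k := {freeg {classic T} / k}.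

Definition fbase (T : Type) (t : T) : free_mod T := << (t : {classic T}) >>.

Definition flift (T : Type) (M : lmodType k) (f : T -> M) : free_mod T -> M :=
  @fglift k M {classic T} f.

Lemma flift_is_linear (T : Type) (M : lmodType k) (f : T -> M) : linear (flift f).
Proof.
move=> c a b; pose L := flift f.
have LB : {morph L : u v / u - v} by exact: lift_is_additive.
have L0 : L 0 = 0 by rewrite -(subrr 0) LB subrr.
have LN u : L (- u) = - L u by rewrite -[- u]sub0r LB L0 sub0r.
have LD u v : L (u + v) = L u + L v by rewrite -{1}[v]opprK LB LN opprK.
rewrite -[LHS]/(L _) LD; congr (_ + _).
rewrite -/(L a) -[a]freeg_sumE; elim: (dom a) => [|t s IHs].
  by rewrite !big_nil L0 !scaler0 L0.
rewrite !big_cons scalerDr !LD IHs scalerDr; congr (_ + _).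
have -> : c *: (<< (coeff t a) *g t >> : free_mod T) = << c * coeff t a *g t >>.
  by apply/eqP/freeg_eqP => u; rewrite coeffZ !coeffU mulrA.
by rewrite /L /flift !liftU scalerA.
Qed.

HB.instance Definition _ (T : Type) (M : lmodType k) (f : T -> M) :=
  GRing.isLinear.Build k (free_mod T) M _ (flift f) (flift_is_linear f).

Lemma flift_base (T : Type) (M : lmodType k) (f : T -> M) t :
  flift f (fbase t) = f t.
Proof. by rewrite /flift /fbase liftU scale1r. Qed.

Definition fcoef (T : Type) (t : T) : {linear free_mod T -> k^o} :=
  @flift T k^o (fun u => (`[< u = t >])%:R : k^o).

Lemma fcoef_base (T : Type) (t u : T) : fcoef t (fbase u) = (`[< u = t >])%:R.
Proof. exact: (flift_base (M := k^o)). Qed.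

Lemma fcoef_base1 (T : Type) (t : T) : fcoef t (fbase t) = 1.
Proof. by rewrite fcoef_base; case: asboolP. Qed.

Lemma fbase_inj (T : Type) : injective (@fbase T).
Proof.
move=> t u E; have := fcoef_base1 u; rewrite -E fcoef_base.
by case: asboolP => // _ /eqP; rewrite eq_sym oner_eq0.
Qed.

Lemma fcoefE (T : Type) (t : T) a : fcoef t a = coeff (t : {classic T}) a.
Proof.
rewrite -[a]freeg_sumE linear_sum raddf_sum; apply: eq_bigr => u _.
by rewrite /fcoef /= /flift liftU coeffU.
Qed.

Lemma free_modP (T : Type) (a b : free_mod T) :
  (forall t, fcoef t a = fcoef t b) -> a = b.
Proof. by move=> E; apply/eqP/freeg_eqP => t; rewrite -!fcoefE. Qed.

Lemma free_mod_sum (T : Type) (a : free_mod T) :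
  exists s : seq {classic T}, a = \sum_(t <- s) fcoef t a *: fbase t.
Proof.
exists (dom a); rewrite -{1}[a]freeg_sumE; apply: eq_bigr => t _.
apply/eqP/freeg_eqP => u; rewrite coeffZ !coeffU mul1r; congr (_ * _).
Qed.

Lemma free_mod_span (T : Type) (a : free_mod T) : lin_span (range (@fbase T)) a.
Proof.
have [s ->] := free_mod_sum a; apply: submodule_sum => [|t].
  exact: submodule_span.
by apply: submoduleZ; [exact: submodule_span|apply: sub_lin_span; exists t].
Qed.

Lemma free_mod_ind (T : Type) (U : set (free_mod T)) :
  submodule (free_mod T) U -> (forall t, U (fbase t)) -> forall a, U a.
Proof.
move=> sU Ub a; apply: (lin_span_sub sU _ (free_mod_span a)).
by move=> _ [t _ <-].
Qed.

Lemma free_mod_eq (T : Type) (M : lmodType k) (f g : {linear free_mod T -> M}) :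
  (forall t, f (fbase t) = g (fbase t)) -> f =1 g.
Proof.
move=> fg a; apply: (@free_mod_ind T [set a | f a = g a]) => //.
apply/submoduleP; split; first by rewrite /= !linear0.
by move=> c u v /= fu fv; rewrite !linearP fu fv.
Qed.

Lemma free_mod_mem (T : Type) (C : set T) t :
  lin_span [set (fbase u : free_mod T) | u in C] (fbase t) -> C t.
Proof.
move=> Ct; apply: contrapT => nCt.
suff : fcoef t (fbase t : free_mod T) = 0.
  by rewrite fcoef_base1 => /eqP; rewrite oner_eq0.
move: Ct; apply: (@lin_span_sub _ _ _ [set a : free_mod T | fcoef t a = 0]).
  exact: submodule_ker.
move=> _ [u Cu <-]; rewrite /mkset fcoef_base.
by case: asboolP => // ut; case: nCt; rewrite -ut.
Qed.

End FreeModules.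

Arguments fbase {k T} t.
Arguments fcoef {k T} t.

(** * Representables and the action of linear combinations of arrows *)

Section Representables.
Context (k : comNzRingType) (D : smallCategory).

(** The action on [V] of the [k]-linear category spanned by [D]. *)
Definition lact (V : representation k D) (y z : D) (a : free_mod k (Mor y z))
  (v : V y) : V z := flift (fun f => rep_map V f v) a.

Section Lact.
Context (V : representation k D) (y z : D).

Lemma lact_base (f : Mor y z) (v : V y) : lact (fbase f) v = rep_map V f v.
Proof. exact: flift_base. Qed.

Lemma lact_linearl (v : V y) : linear (fun a : free_mod k (Mor y z) => lact a v).
Proof. exact: flift_is_linear. Qed.

Lemma lact0l (v : V y) : lact (0 : free_mod k (Mor y z)) v = 0.
Proof. exact: linear0. Qed.

Lemma lact_linearr (a : free_mod k (Mor y z)) : linear (fun v : V y => lact a v).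
Proof.
move=> c u v; move: a; apply: free_mod_ind => [|f]; last first.
  by rewrite /= !lact_base linearP.
apply/submoduleP; split; first by rewrite /= !lact0l scaler0 addr0.
move=> d a b /= Ea Eb; rewrite !lact_linearl Ea Eb.
by rewrite !scalerDr !scalerA addrACA mulrC.
Qed.

HB.instance Definition _ (a : free_mod k (Mor y z)) :=
  GRing.isLinear.Build k (V y) (V z) _ (lact a) (lact_linearr a).

Lemma lactDl (a b : free_mod k (Mor y z)) (v : V y) :
  lact (a + b) v = lact a v + lact b v.
Proof. exact: linearD. Qed.

Lemma lactBl (a b : free_mod k (Mor y z)) (v : V y) :
  lact (a - b) v = lact a v - lact b v.
Proof. exact: linearB. Qed.

Lemma lactZl c (a : free_mod k (Mor y z)) (v : V y) :
  lact (c *: a) v = c *: lact a v.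
Proof. exact: linearZ. Qed.

End Lact.

Section Representable.
Context (d : D).

Definition rpr_ob (x : D) : lmodType k := free_mod k (Mor d x).

Definition rpr_map (x y : D) (f : Mor x y) : {linear rpr_ob x -> rpr_ob y} :=
  @flift k (Mor d x) (rpr_ob y) (fun g => fbase (compm f g)).

Lemma rpr_map_id x (v : rpr_ob x) : rpr_map (idm x) v = v.
Proof.
apply: (@free_mod_eq _ _ _ _ idfun) => f /=.
by rewrite flift_base compm_idl.
Qed.

Lemma rpr_map_comp x y z (g : Mor y z) (f : Mor x y) (v : rpr_ob x) :
  rpr_map (compm g f) v = rpr_map g (rpr_map f v).
Proof.
apply: (@free_mod_eq _ _ _ _ (rpr_map g \o rpr_map f)) => h /=.
by rewrite !flift_base compm_assoc.
Qed.

Definition representable : representation k D :=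
  Representation rpr_map_id rpr_map_comp.

Lemma representable_base x y (f : Mor x y) (g : Mor d x) :
  rep_map representable f (fbase g) = fbase (compm f g).
Proof. exact: flift_base. Qed.

Lemma representable_fg : finitely_generated representable.
Proof.
exists 1%N, (fun=> d), (fun=> fbase (idm d)) => x; apply/seteqP; split=> // v _.
apply: lin_spanS (free_mod_span v) => _ [f _ <-]; exists ord0, f.
by rewrite representable_base compm_idr.
Qed.

End Representable.

Lemma lact_id (V : representation k D) y (v : V y) : lact (fbase (idm y)) v = v.
Proof. by rewrite lact_base rep_map_id. Qed.

Lemma lact_comp (V : representation k D) x y z (a : free_mod k (Mor y z))
    (b : free_mod k (Mor x y)) (v : V x) :
  lact (lact (V := representable x) a b) v = lact a (lact b v).
Proof.
move: a; apply: free_mod_ind => [|g].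
  apply/submoduleP; split; first by rewrite /= !(lact0l, linear0).
  by move=> c a a' /= E E'; rewrite !lact_linearl E E'.
move: b; apply: free_mod_ind => [|f].
  apply/submoduleP; split; first by rewrite /= !(lact0l, linear0).
  by move=> c b b' /= E E'; rewrite linearP !lact_linearl E E' linearP.
by rewrite /= !lact_base representable_base lact_base rep_map_comp.
Qed.

End Representables.

(** * Left ideals of an algebra of finite length *)

Section LeftIdeals.
Context (k : comNzRingType) (A : algType k).
Implicit Types (U F : set A) (a b c e u v w : A).

Definition left_ideal : set (set A) :=
  [set U | U 0 /\ forall a u v, U u -> U v -> U (a * u + v)].

Section Closure.
Context (U : set A) (lU : left_ideal U).

Lemma left_idealM a u : U u -> U (a * u).
Proof. by move=> Uu; rewrite -[_ * _]addr0; case: lU => U0; apply. Qed.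

Lemma left_ideal_submodule : submodule A U.
Proof.
apply/submoduleP; case: (lU) => U0 UD; split=> // c u v Uu Uv.
by rewrite -mulr_algl; apply: UD.
Qed.

End Closure.

Lemma left_ideal0 : left_ideal [set 0].
Proof. by split=> // a u v -> ->; rewrite mulr0 addr0. Qed.

Lemma left_idealT : left_ideal setT.
Proof. by []. Qed.

Definition lideal b : set A := [set a * b | a in setT].

Lemma left_ideal_lideal b : left_ideal (lideal b).
Proof.
split; first by exists 0; rewrite ?mul0r.
by move=> a _ _ [c _ <-] [d _ <-]; exists (a * c + d); rewrite // mulrDl mulrA.
Qed.

Lemma lideal_refl b : lideal b b.
Proof. by exists 1; rewrite ?mul1r. Qed.

Lemma lideal_sub b c : lideal c b -> lideal b `<=` lideal c.
Proof. by move=> [d _ <-] _ [a _ <-]; exists (a * d); rewrite // mulrA. Qed.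

Lemma left_ideal_line U u : left_ideal U ->
  left_ideal [set w | exists a, U (w - a * u)].
Proof.
move=> [U0 UD]; split; first by exists 0; rewrite mul0r subr0.
move=> a v w [c Uc] [d Ud]; exists (a * c + d).
have -> : a * v + w - (a * c + d) * u = a * (v - c * u) + (w - d * u).
  by rewrite mulrBr mulrDl opprD mulrA addrACA.
exact: UD.
Qed.

(** A nonzero vector generates a simple module. *)
Lemma covers_line U F u : covers left_ideal (@nested true A) U F ->
  F u -> ~ U u -> forall w, F w -> exists a, U (w - a * u).
Proof.
move=> [lU lF UF _ cov] Fu nUu w Fw.
have [|||E|E] := cov (F `&` [set w | exists a, U (w - a * u)]).
- have [_ LD] := left_ideal_line u lU; have [F0 FD] := lF.
  split; first by split=> //; exists 0; rewrite mul0r subr0; case: lU.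
  move=> a v v' [Fv Lv] [Fv' Lv']; split; first exact: FD.
  exact: LD.
- by move=> v Uv; split; [exact: UF|exists 0; rewrite mul0r subr0].
- by move=> v [].
- case: nUu; rewrite -E; split=> //; exists 1; rewrite mul1r subrr.
  by case: lU.
- by move: Fw; rewrite -E => -[].
Qed.

Hypothesis acc : stationary left_ideal (@nested true A).
Hypothesis dcc : stationary left_ideal (@nested false A).

(** Right multiplication by [u] maps [A u] onto [A u ^+ 2 = A u]; as the
    kernels of its powers stabilise, it is also injective there (Fitting). *)
Lemma mulr_injective v u a : u = v * u * u -> lideal u a -> a * u = 0 -> a = 0.
Proof.
move=> uE [b _ <-] bu.
have uE' n : u = v ^+ n * u ^+ n.+1.
  elim: n => [|n IHn]; first by rewrite mul1r expr1.
  have -> : v ^+ n.+1 * u ^+ n.+2 = v * (v ^+ n * u ^+ n.+1) * u.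
    by rewrite exprS [u ^+ n.+2]exprSr !mulrA.
  by rewrite -IHn.
have [||N] := acc (W := fun n => [set c | c * u ^+ n = 0]).
- move=> n; split; first by rewrite /= mul0r.
  by move=> c w w' /= h h'; rewrite mulrDl -mulrA h h' mulr0 addr0.
- by move=> n c /= h; rewrite exprSr mulrA h mul0r.
move=> E; pose K n : set A := [set c | c * u ^+ n = 0].
have {E}KN : K N.+1 = K N.+2.
  by transitivity (K N); [|symmetry]; apply: E; rewrite // ltnW.
have : K N.+1 (b * v ^+ N).
  by rewrite KN /K /mkset exprSr mulrA -[b * _ * _]mulrA -uE'.
by rewrite (uE' N) mulrA.
Qed.

Lemma idempotent_of_reg v u : u = v * u * u -> (v * u) * (v * u) = v * u.
Proof.
move=> uE; apply/eqP; rewrite -subr_eq0; apply/eqP.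
have vuu : v * (u * u) = u by rewrite mulrA -uE.
apply: (mulr_injective uE); last by rewrite mulrBl -!mulrA !vuu subrr.
by exists (v * u * v - v); rewrite // mulrBl !mulrA.
Qed.

(** A left ideal maximal among those generated by finitely many elements of [X]
    contains [X]. *)
Lemma left_noetherian (X : set A) : exists2 s : seq A, (forall x, x \in s -> X x) &
  forall U, left_ideal U -> (forall x, x \in s -> U x) -> X `<=` U.
Proof.
pose gen (s : seq A) : set A :=
  [set w | forall U, left_ideal U -> (forall x, x \in s -> U x) -> U w].
have lgen s : left_ideal (gen s).
  split=> [U [] //|a u v gu gv U lU sU].
  by case: (lU) => _; apply; [exact: gu|exact: gv].
have [||m [s [sX ->]] maxm] := stationary_maximal
  (Q := [set U | exists s, (forall x, x \in s -> X x) /\ U = gen s]) acc.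
- by move=> _ [s [_ ->]].
- by exists (gen [::]), [::].
exists s => // U lU sU x Xx.
suff : gen s x by apply.
rewrite -(maxm (gen (x :: s))).
- by move=> V _; apply; rewrite inE eqxx.
- by exists (x :: s); split=> // y; rewrite inE => /orP[/eqP ->|/sX].
- by move=> w gw V lV sV; apply: gw => // y ys; apply: sV; rewrite inE ys orbT.
Qed.

(** A character [chi] of the corner ring [e A e] has, as in the case of the
    trivial representation of a group, a projective cover [A eps]; the simple
    module attached to [chi] has multiplicity at most one in each simple
    factor, so [eps A], which counts these multiplicities, is finite over [k]. *)
Lemma character_idempotent e (chi : {linear A -> k^o}) :
  chi e = 1 -> e * e = e -> (forall a b, chi (a * e * b) = chi a * chi b) ->
  exists eps, [/\ e * eps = eps, eps * e = eps, chi eps = 1 &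
    exists s, forall a, sspan s (eps * a)].
Proof.
move=> chie ee chiM.
have [||_ [b [[eb be chib] ->]] minb] := stationary_maximal
  (Q := [set U | exists b, [/\ e * b = b, b * e = b & chi b = 1] /\ U = lideal b]) dcc.
- by move=> _ [b [_ ->]]; apply: left_ideal_lideal.
- by exists (lideal e), e.
have minlb c : e * c = c -> c * e = c -> chi c = 1 -> lideal b c -> lideal c b.
  move=> ec ce chic bc; rewrite (minb (lideal c)); first exact: lideal_refl.
    by exists c.
  exact: lideal_sub.
have chibb : chi (b * b) = 1 by rewrite -{1}be chiM chib mulr1.
have [v0 _ bE0] : lideal (b * b) b.
  by apply: minlb => //; [rewrite mulrA eb|rewrite -mulrA be|exists b].
pose v := e * v0 * e.
have bE : b = v * b * b.
  by rewrite /v -[e * v0 * e * b]mulrA eb -!mulrA bE0.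
have ev : e * v = v by rewrite /v !mulrA ee.
have chiv : chi v = 1.
  have ve : v * e = v by rewrite /v -!mulrA ee.
  have : chi (v * e * (b * b)) = 1 by rewrite ve mulrA -bE.
  by rewrite chiM chibb mulr1.
clearbody v.
(* [A b] is minimal, hence so is [A eps]: elements of [eps A eps] on which [chi]
   is [1] are left invertible there, i.e. this corner ring is local. *)
exists (v * b); set eps := v * b.
have epsE : eps * eps = eps by apply: idempotent_of_reg.
have eeps : e * eps = eps by rewrite /eps mulrA ev.
have epse : eps * e = eps by rewrite /eps -mulrA be.
have chieps : chi eps = 1 by rewrite /eps -eb mulrA chiM chiv chib mulr1.
have inv c : eps * c = c -> c * eps = c -> chi c = 1 -> lideal c eps.
  move=> ec ce chic.
  have : lideal c b.
    apply: minlb => //; first by rewrite -ec mulrA eeps.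
      by rewrite -ce -mulrA epse.
    by exists (c * v); rewrite // -mulrA.
  by move=> /lideal_sub; apply; exists v.
split=> //; clearbody eps.
suff [s sT] : exists s, forall u, setT u -> sspan s (eps * u).
  by exists s => a; apply: sT.
apply: (@finite_length_ind (set A) left_ideal (@nested true A) [set 0] setT
  (fun U => exists s, forall u, U u -> sspan s (eps * u)) acc dcc).
- exact: left_ideal0.
- exact: left_idealT.
- by move=> U _ u.
- exists [::] => _ ->; rewrite mulr0; exact: (submodule0 (submodule_sspan _)).
move=> U F cov [s sU]; have [lU lF UF _ _] := cov.
have [epsF|] := pselect (forall u, F u -> U (eps * u)).
  by exists s => u /epsF/sU; rewrite mulrA epsE.
move=> /existsNP[u1 /not_implyP[Fu1 nUu1]].
pose u0 := eps * u1; have epsu0 : eps * u0 = u0 by rewrite /u0 mulrA epsE.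
have Fu0 : F u0 by apply: (left_idealM lF).
have {nUu1} nUu0 : ~ U u0 by [].
clearbody u0.
exists (u0 :: s) => w Fw.
have ss := submodule_sspan (u0 :: s).
have sub u : U u -> sspan (u0 :: s) (eps * u).
  by move=> /sU; apply: sspanS => x xs; rewrite inE xs orbT.
have [a Ua] := covers_line cov Fu0 nUu0 Fw.
(* [kap] lies in the radical of the local ring [eps A eps], so it kills
   [eps (F / U)], which is thus spanned over [k] by [u0]. *)
pose kap := eps * a * eps - chi a *: eps.
have epskap : eps * kap = kap by rewrite /kap mulrBr !mulrA -scalerAr epsE.
have kapeps : kap * eps = kap by rewrite /kap mulrBl -scalerAl -!mulrA epsE.
have chia c : chi (eps * c) = chi c by rewrite -epse chiM chieps mul1r.
have chic c : chi (c * eps) = chi c by rewrite -eeps mulrA chiM chieps mulr1.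
have chikap : chi kap = 0.
  rewrite /kap linearB linearZ /= chic chia chieps.
  by rewrite [X in _ - X](mulr1 (chi a)) subrr.
have Ukap : U (kap * u0).
  apply: contrapT => nU.
  have [c Uc] := covers_line cov (left_idealM lF kap Fu0) nU Fu0.
  have [c' _ epsc] : lideal (eps - eps * c * kap) eps.
    apply: inv.
    - by rewrite mulrBr !mulrA epsE.
    - by rewrite mulrBl -(mulrA (eps * c)) kapeps epsE.
    - have ekap : e * kap = kap by rewrite -epskap mulrA eeps.
      rewrite linearB chieps -(mulrA eps) chia -ekap (mulrA c) chiM chikap.
      by rewrite [X in _ - X](mulr0 (chi c)) subr0.
  apply: nUu0; rewrite -epsu0 -epsc -mulrA.
  apply: (left_idealM lU); rewrite mulrBl -!mulrA -mulrBr.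
  exact: (left_idealM lU).
have -> : eps * w = eps * (w - a * u0) + (eps * (kap * u0) + chi a *: u0).
  rewrite mulrBr [eps * (kap * _)]mulrA epskap /kap mulrBl -scalerAl epsu0.
  by rewrite subrK -[u0 in eps * a * eps * u0]epsu0 !mulrA -[_ * eps * eps]mulrA epsE
    -!mulrA epsu0 subrK.
apply: (submoduleD ss); first exact: sub.
apply: (submoduleD ss); first exact: sub.
by apply/(submoduleZ ss)/mem_sspan; rewrite inE eqxx.
Qed.

End LeftIdeals.

(** * Algebras with a multiplicative basis *)

Section MultiplicativeBasis.
Context (k : comNzRingType) (A : algType k) (B : set A).
(** [B] is a basis that is a monoid; freeness is expressed by the existence of
    linear functionals with prescribed values on [B]. *)
Hypothesis B1 : B 1.
Hypothesis BM : forall s t, B s -> B t -> B (s * t).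
Hypothesis Bspan : forall a, lin_span B a.
Hypothesis Bfree : forall f : A -> k,
  exists phi : {linear A -> k^o}, forall t, B t -> phi t = f t.
Hypothesis kacc : stationary (submodule k^o) (@nested true _).
Hypothesis acc : stationary (@left_ideal k A) (@nested true A).
Hypothesis dcc : stationary (@left_ideal k A) (@nested false A).

Definition coord (t : A) : {linear A -> k^o} :=
  projT1 (cid (Bfree (fun u => (`[< u = t >])%:R))).

Lemma coordE t u : B u -> coord t u = (`[< u = t >])%:R.
Proof. exact: (projT2 (cid (Bfree (fun u => (`[< u = t >])%:R)))). Qed.

Lemma coord1 t : B t -> coord t t = 1.
Proof. by move=> Bt; rewrite coordE //; case: asboolP. Qed.

Lemma basis_ind (U : set A) : submodule A U -> B `<=` U -> forall a, U a.
Proof. by move=> sU BU a; apply: (lin_span_sub sU BU (Bspan a)). Qed.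

Lemma basis_mem (C : set A) t : C `<=` B -> B t -> lin_span C t -> C t.
Proof.
move=> CB Bt Ct; apply: contrapT => nCt.
suff : coord t t = 0 by rewrite coord1 // => /eqP; rewrite oner_eq0.
move: Ct; apply: (@lin_span_sub _ _ C [set a | coord t a = 0]).
  exact: submodule_ker.
move=> c Cc /=; rewrite coordE; last exact: CB.
by case: asboolP => // ct; case: nCt; rewrite -ct.
Qed.

(** Inside [B], divisibility in [A] is divisibility in the monoid. *)
Lemma basis_lideal t u : B t -> B u -> lideal u t -> exists2 m, B m & t = m * u.
Proof.
move=> Bt Bu [a _ aE].
have [] : [set m * u | m in B] t; last by move=> m Bm <-; exists m.
apply: basis_mem => //; first by move=> _ [m Bm <-]; apply: BM.
rewrite -aE; move: a {aE}; apply: basis_ind => [|m Bm]; last first.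
  by apply: sub_lin_span; exists m.
have sS := submodule_span [set m * u | m in B].
apply/submoduleP; split; first by rewrite /= mul0r; apply: submodule0.
move=> c a b /= Sa Sb; rewrite mulrDl -scalerAl.
by apply: submoduleD => //; apply: submoduleZ.
Qed.

Lemma basis_seq a : exists2 r : seq A, (forall x, x \in r -> B x) & sspan r a.
Proof.
move: a; apply: basis_ind => [|t Bt]; last first.
  exists [:: t]; first by move=> x; rewrite inE => /eqP ->.
  by apply: mem_sspan; rewrite inE.
apply/submoduleP; split.
  by exists [::] => //; apply: (submodule0 (submodule_sspan _)).
move=> c a b [r rB ra] [r' rB' rb]; exists (r ++ r').
  by move=> x; rewrite mem_cat => /orP[/rB|/rB'].
have ss := submodule_sspan (r ++ r').
apply: (submoduleD ss); first apply: (submoduleZ ss).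
  by apply: sspanS ra => x xr; rewrite mem_cat xr.
by apply: sspanS rb => x xr; rewrite mem_cat xr orbT.
Qed.

Lemma basis_seqs (s : seq A) :
  exists2 r : seq A, (forall x, x \in r -> B x) & sspan s `<=` sspan r.
Proof.
elim: s => [|a s [r rB sr]].
  by exists [::].
have [r' rB' ra] := basis_seq a; exists (r ++ r').
  by move=> x; rewrite mem_cat => /orP[/rB|/rB'].
have ss := submodule_sspan (r ++ r').
apply: sspan_sub => // x; rewrite inE => /orP[/eqP ->|xs].
  by apply: sspanS ra => y yr; rewrite mem_cat yr orbT.
by apply: (@sspanS _ _ r) => [y yr|]; [rewrite mem_cat yr|apply/sr/mem_sspan].
Qed.

Lemma coord_sspan (r : seq A) a t : (forall x, x \in r -> B x) -> sspan r a ->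
  coord t a != 0 -> t \in r.
Proof.
move=> rB ra; apply: contraR => tr; apply/eqP.
apply: (@sspan_sub _ _ r [set a | coord t a = 0]) ra => [|u ur].
  exact: submodule_ker.
rewrite /mkset coordE; last exact: rB.
by case: asboolP => // ut; case/negP: tr; rewrite -ut.
Qed.

Lemma coord_expand a : exists r : seq A, a = \sum_(t <- r) coord t a *: t.
Proof.
have [r rB ra] := basis_seq a; exists (undup r).
apply: (@sspan_sub _ _ r [set a | a = \sum_(t <- undup r) coord t a *: t]) ra.
  apply/submoduleP; split.
    by rewrite /= big1 // => t _; rewrite linear0; apply: scale0r.
  move=> c a' b /= Ea Eb; rewrite {1}Ea {1}Eb scaler_sumr -big_split /=.
  by apply: eq_bigr => t _; rewrite scalerA -scalerDl linearP.
move=> u ur; rewrite /mkset (bigD1_seq u) ?mem_undup ?undup_uniq //=.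
rewrite coord1; last exact: rB.
rewrite scale1r big1 ?addr0 // => t tu; rewrite coordE; last exact: rB.
by case: asboolP => [ut|_]; [rewrite ut eqxx in tu|apply: scale0r].
Qed.

Lemma coord_support (phi : {linear A -> k^o}) a :
  phi a != 0 -> exists2 t, coord t a != 0 & phi t != 0.
Proof.
move=> fa; apply: contrapT => no; move/eqP: fa; apply.
have [r ->] := coord_expand a; rewrite linear_sum big1_seq // => t _; rewrite linearZ.
have [E|c0] := eqVneq (coord t a) 0; first by rewrite E; apply: mul0r.
have [E|f0] := eqVneq (phi t) 0; first by rewrite E; apply: mulr0.
by case: no; exists t.
Qed.

Section SimpleFactor.
Variables (U F : set A).
Hypothesis cov : covers (@left_ideal k A) (@nested true A) U F.

Let lU : left_ideal U. Proof. by case: cov. Qed.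
Let lF : left_ideal F. Proof. by case: cov. Qed.
Let UF : U `<=` F. Proof. by case: cov. Qed.
Let sU : submodule A U. Proof. exact: left_ideal_submodule. Qed.

(** [r] annihilates the simple module [F / U]. *)
Definition kills (r : A) : Prop := forall v, F v -> U (r * v).

Lemma kills_mull a r : kills r -> kills (a * r).
Proof. by move=> kr v Fv; rewrite -mulrA; apply: (left_idealM lU); apply: kr. Qed.

Lemma kills_mulr a r : kills r -> kills (r * a).
Proof. by move=> kr v Fv; rewrite -mulrA; apply/kr/(left_idealM lF). Qed.

Lemma kills_submodule b c : submodule A [set a | kills (b * a * c)].
Proof.
apply/submoduleP; split; first by move=> v Fv; rewrite mulr0 !mul0r; case: lU.
move=> d a a' ka ka' v Fv; rewrite mulrDr !mulrDl -scalerAr -!scalerAl.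
apply: (submoduleD sU); last exact: ka'.
by apply: (submoduleZ sU); apply: ka.
Qed.

Lemma kills1 : ~ kills 1.
Proof.
case: cov => _ _ _ nUF _ k1; apply: nUF; apply/seteqP; split=> // v /k1.
by rewrite mul1r.
Qed.

(** Simplicity of [F / U] makes its annihilator a prime ideal; testing on the
    basis produces a basis element between [x] and [y]. *)
Lemma kills_prime x y : ~ kills x -> ~ kills y -> exists2 z, B z & ~ kills (x * z * y).
Proof.
move=> nx ny; apply: contrapT => no; apply: nx => v Fv.
move: ny => /existsNP[u /not_implyP[Fu nUu]].
have [a Ua] := covers_line cov (left_idealM lF y Fu) nUu Fv.
have kxay : kills (x * a * y).
  move: a {Ua}; apply: basis_ind => [|z Bz]; first exact: kills_submodule.
  by apply: contrapT => nk; apply: no; exists z.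
rewrite -[v](subrK (a * (y * u))) mulrDr; apply: (submoduleD sU).
  exact: (left_idealM lU).
by rewrite !mulrA -[x * a * y * u]mulrA mulrA; apply: kxay.
Qed.

(** Let [x] generate a minimal left ideal [A x] among the elements of [B] that
    do not kill [F / U], and choose [z] such that [x z x] does not kill it.
    Then [u = z x] and [u ^+ 2] generate the same left ideal, so [u = v u ^+ 2]
    and [v u] is idempotent. *)
Lemma basis_idempotent : exists e, [/\ B e, ~ kills e, e * e = e &
  forall y, B y -> lideal e y -> ~ kills y -> lideal y e].
Proof.
have [||_ [x [Bx nx ->]] minx] := stationary_maximal
  (Q := [set V | exists x, [/\ B x, ~ kills x & V = lideal x]]) dcc.
- by move=> _ [b [_ _ ->]]; apply: left_ideal_lideal.
- by exists (lideal 1), 1; split=> //; apply: kills1.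
have minlx y : B y -> ~ kills y -> lideal x y -> lideal y = lideal x.
  by move=> By ny xy; apply: minx; [exists y|apply: lideal_sub].
have [z Bz nxzx] := kills_prime nx nx.
have [u Bu uzx] : exists2 u, B u & u = z * x by exists (z * x) => //; apply: BM.
have xu : lideal x u by exists z.
have [w _ wE] : lideal (x * u) x.
  rewrite minlx //; first exact: lideal_refl.
  - exact: BM.
  - by rewrite uzx mulrA.
  - by exists (x * z); rewrite // uzx mulrA.
have nuu : ~ kills (u * u).
  move=> kuu; apply: nx; rewrite -wE -wE -!mulrA.
  by do 3!apply: kills_mull.
have [v Bv uE] : exists2 v, B v & u = v * (u * u).
  apply: basis_lideal => //; first exact: BM.
  rewrite minlx //; first exact: BM.
  by exists (u * z); rewrite // {3}uzx mulrA.
have uE' : u = v * u * u by rewrite -mulrA.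
exists (v * u); split.
- exact: BM.
- by move=> kvu; apply: nuu; rewrite {1}uE' -mulrA; apply: kills_mulr.
- exact: (idempotent_of_reg acc).
move=> y By ey ny; have xvu : lideal x (v * u).
  by apply: lideal_sub xu _ _; exists v.
rewrite minlx //; exact: (lideal_sub xvu).
Qed.

Section Corner.
Variable e : A.
Hypotheses (Be : B e) (ne : ~ kills e) (ee : e * e = e).
Hypothesis min_e : forall y, B y -> lideal e y -> ~ kills y -> lideal y e.

(** By [min_e] these elements of the monoid [e B e] are left invertible, so they
    form a group with unit [e]. *)
Definition unit_group : set A :=
  [set g | [/\ B g, e * g = g, g * e = g & ~ kills g]].

Lemma unit_group_linv g : unit_group g -> exists2 h, unit_group h & h * g = e.
Proof.
move=> [Bg eg ge ng].
have [c Bc ec] : exists2 c, B c & e = c * g.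
  by apply: basis_lideal => //; apply: min_e => //; exists g.
exists (e * c * e); last by rewrite -mulrA eg -mulrA -ec ee.
split.
- by apply: BM => //; apply: BM.
- by rewrite !mulrA ee.
- by rewrite -!mulrA ee.
- move=> kece; apply: ne; rewrite -ee {2}ec -eg !mulrA.
  by rewrite -[e * c * e * g]/(_ * g); apply: kills_mulr.
Qed.

Lemma unit_group_inv g : unit_group g ->
  exists h, [/\ unit_group h, h * g = e & g * h = e].
Proof.
move=> Gg; have [h Gh hg] := unit_group_linv Gg.
have [h' Gh' hh] := unit_group_linv Gh; exists h; split=> //.
have [_ eg _ _] := Gg; have [_ _ h'e _] := Gh'.
suff -> : g = h' by [].
by rewrite -eg -hh -mulrA hg h'e.
Qed.

(** The indicator of the group is multiplicative on [e A e] because the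
    elements of [e B e] outside of it form an ideal. *)
Lemma unit_group_character : exists chi : {linear A -> k^o},
  (forall t, B t -> chi t != 0 -> unit_group (e * t * e)) /\
  chi e = 1 /\ forall a b, chi (a * e * b) = chi a * chi b.
Proof.
have [chi chiE] := Bfree (fun t => (`[< ~ kills (e * t * e) >])%:R).
exists chi; split=> [t Bt|].
  rewrite chiE //; case: asboolP => [nk _|_]; last by rewrite eqxx.
  split=> //; first by apply: BM => //; apply: BM.
    by rewrite !mulrA ee.
  by rewrite -!mulrA ee.
split; first by rewrite chiE // !ee; case: asboolP.
have lin1 b : submodule A [set a | chi (a * e * b) = chi a * chi b].
  apply/submoduleP; split; first by rewrite /= !mul0r !linear0 mul0r.
  move=> c a a' /= Ea Ea'; rewrite !mulrDl -!scalerAl !linearP Ea Ea' mulrDl.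
  by congr (_ + _); apply: mulrA.
have lin2 a : submodule A [set b | chi (a * e * b) = chi a * chi b].
  apply/submoduleP; split; first by rewrite /= !mulr0 !linear0 mulr0.
  move=> c b b' /= Eb Eb'; rewrite !mulrDr -!scalerAr !linearP Eb Eb' mulrDr.
  by congr (_ + _); apply: mulrCA.
move=> a b; move: a; apply: (basis_ind (lin1 b)) => m Bm.
move: b; apply: (basis_ind (lin2 m)) => n Bn.
rewrite /mkset !chiE //; last by apply: BM => //; apply: BM.
case: asboolP => [nmn|kmn]; case: asboolP => [nm|km]; case: asboolP => [nn|kn];
  rewrite ?mulr1 ?mul0r ?mulr0 //.
- case: nmn; have := kills_mull (e * m) (contrapT kn).
  by rewrite !mulrA.
- case: nmn; have := kills_mulr (n * e) (contrapT km).
  by rewrite !mulrA.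
- case: nmn; have := kills_mulr (n * e) (contrapT km).
  by rewrite !mulrA.
- exfalso.
  have [c _ cE] : lideal (e * m * e) e.
    by apply: min_e => //; [apply: BM => //; apply: BM|exists (e * m)].
  apply: nn; rewrite -{1}cE -mulrA -!mulrA.
  have {}kmn := contrapT kmn.
  have := kills_mull c kmn; by rewrite !mulrA.
Qed.

(** All the [eps * g], for [g] in the group, lie in the finitely generated module
    [eps A], hence are supported by one finite set [r].  If the group element
    [t0] is in the support of [eps], then [t0 * g] is in that of [eps * g],
    right multiplication by [g] being injective on [B e]. *)
Lemma unit_group_finite : exists r : seq A, forall g, unit_group g -> g \in r.
Proof.
have [chi [chiG [chie chiM]]] := unit_group_character.
have [eps [eeps epse chieps [s sT]]] := character_idempotent acc dcc chie ee chiM.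
have [t0 ct0 chit0] : exists2 t, coord t eps != 0 & chi t != 0.
  by apply: coord_support; rewrite chieps; apply: oner_neq0.
have [r0 rB0 r0eps] := basis_seq eps.
have Bt0 : B t0 by apply/rB0/(coord_sspan rB0 r0eps).
have lin (f : {linear A -> k^o}) (g : {linear A -> k^o}) :
  (forall t, B t -> f t = g t) -> forall a, f a = g a.
  move=> fg; apply: basis_ind => //; apply/submoduleP; split.
    by rewrite /= !linear0.
  by move=> c u v /= Eu Ev; rewrite !linearP Eu Ev.
have [r rB sr] := basis_seqs s.
have t0e : e * t0 * e = t0.
  have : coord t0 (e * eps * e) != 0 by rewrite eeps epse.
  apply: contraNeq => /eqP nt0; apply/eqP.
  move: (eps); apply: basis_ind => [|t Bt].
    apply/submoduleP; split; first by rewrite /= mulr0 mul0r linear0.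
    move=> c u v /= Eu Ev; rewrite mulrDr mulrDl -scalerAr -scalerAl linearP Eu Ev.
    by rewrite addr0; apply: mulr0.
  rewrite /mkset coordE; last by apply: BM => //; apply: BM.
  case: asboolP => // tE; case: nt0; rewrite -tE.
  by rewrite !mulrA ee -!mulrA ee.
have Gt0 : unit_group t0 by rewrite -t0e; apply: chiG.
have [h0 [Gh0 h0t0 _]] := unit_group_inv Gt0.
exists (map (fun y => h0 * y) r) => g Gg.
have [Bg eg ge _] := Gg.
apply/mapP; exists (t0 * g); last by rewrite mulrA h0t0 eg.
apply: (coord_sspan rB (a := eps * g)); first exact/sr/sT.
have [h [[_ _ he _] _ gh]] := unit_group_inv Gg.
have -> : coord (t0 * g) (eps * g) = coord t0 (eps * e); last by rewrite epse.
move: (eps); apply: basis_ind => [|t Bt].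
  apply/submoduleP; split; first by rewrite /= !mul0r !linear0.
  by move=> c u v /= Eu Ev; rewrite !mulrDl -!scalerAl !linearP Eu Ev.
have [_ _ t0e' _] := Gt0.
rewrite /mkset !coordE //; try exact: BM.
congr (_%:R); congr nat_of_bool; apply: asbool_equiv_eq; split=> [E|E].
  by rewrite -gh mulrA E -mulrA gh t0e'.
by rewrite -E -mulrA eg.
Qed.

(** [e (F / U)] is spanned over [k] by the orbit of any of its nonzero vectors
    [v] under the group: the other elements of [e B e] kill it. *)
Lemma corner_fg : exists s : seq A, forall w, F w ->
  exists2 y, sspan s y & U (e * w - y).
Proof.
have [r rG] := unit_group_finite.
move: ne => /existsNP[v0 /not_implyP[Fv0 nUv0]].
pose v := e * v0; have ev : e * v = v by rewrite /v mulrA ee.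
have Fv : F v by apply: (left_idealM lF).
exists (map (fun g => g * v) r) => w Fw.
have ss := submodule_sspan (map (fun g => g * v) r).
have [a Ua] := covers_line cov Fv nUv0 Fw.
suff [y sy Uy] : exists2 y, sspan (map (fun g => g * v) r) y & U (e * (a * v) - y).
  exists y => //; rewrite -[w](subrK (a * v)) mulrDr -addrA.
  by apply: (submoduleD sU) => //; apply: (left_idealM lU).
move: a {Ua}; apply: basis_ind => [|m Bm].
  apply/submoduleP; split.
    exists 0; first exact: submodule0.
    by rewrite mul0r mulr0 subr0; case: lU.
  move=> c a b [y sy Uy] [z sz Uz]; exists (c *: y + z).
    by apply: (submoduleD ss) => //; apply: (submoduleZ ss).
  have -> : e * ((c *: a + b) * v) - (c *: y + z) =
      c *: (e * (a * v) - y) + (e * (b * v) - z).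
    by rewrite mulrDl mulrDr -scalerAl -scalerAr scalerBr opprD addrACA.
  by apply: (submoduleD sU) => //; apply: (submoduleZ sU).
have [kem|nem] := pselect (kills (e * m * e)).
  exists 0; first exact: (submodule0 ss).
  by rewrite subr0 -ev !mulrA -mulrA; have := kem v Fv; rewrite !mulrA.
exists (e * m * e * v); last first.
  by rewrite -!mulrA ev subrr; case: lU.
apply: mem_sspan; apply: map_f; apply: rG; split=> //.
- by apply: BM => //; apply: BM.
- by rewrite !mulrA ee.
- by rewrite -!mulrA ee.
Qed.

End Corner.

(** If [m_1 ... m_p] are such that the [e m_i] generate the left ideal [A e A],
    then [w |-> (e m_i w)_i] embeds [F / U] in a power of [e (F / U)].  The
    vectors of coefficients of the [e m_i w] on a generating family of
    [e (F / U)] form a submodule of a free module, which is finitely generated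
    as [k] is noetherian; preimages of its generators generate [F / U]. *)
Lemma simple_factor_fg : exists s : seq A, forall w, F w ->
  exists2 y, sspan s y & U (w - y).
Proof.
have [e [Be ne ee min_e]] := basis_idempotent.
have [s sE] := corner_fg Be ne ee min_e.
have [ms msB msgen] := left_noetherian acc [set e * m | m in setT].
pose p := size ms; pose q := size s.
(* Row [i] of [C] expresses [ms`_i * v] on the generators [s], modulo [U]. *)
pose Rel (v : A) (C : 'M[k]_(p, q)) :=
  forall i : 'I_p, U (ms`_i * v - \sum_(j < q) C i j *: s`_j).
have relD c v w C C' : Rel v C -> Rel w C' -> Rel (c *: v + w) (c *: C + C').
  move=> RC RC' i.
  have -> : ms`_i * (c *: v + w) - \sum_(j < q) (c *: C + C') i j *: s`_j =
     c *: (ms`_i * v - \sum_(j < q) C i j *: s`_j)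
     + (ms`_i * w - \sum_(j < q) C' i j *: s`_j).
    rewrite mulrDr -scalerAr scalerBr addrACA -opprD; congr (_ - _).
    rewrite scaler_sumr -big_split; apply: eq_bigr => j _.
    by rewrite !mxE scalerDl scalerA.
  by apply: (submoduleD sU) => //; apply: (submoduleZ sU).
have relE v : F v -> exists C, Rel v C.
  move=> Fv.
  have /choice[c cE] : forall i : 'I_p, exists c : 'rV[k]_q,
      U (ms`_i * v - \sum_(j < q) c ord0 j *: s`_j).
    move=> i; have [m _ mE] := msB _ (mem_nth 0 (ltn_ord i)).
    have [y sy Uy] := sE _ (left_idealM lF m Fv).
    suff [c cE] : exists c : 'rV[k]_q, y = \sum_(j < q) c ord0 j *: s`_j.
      by exists c; rewrite -cE -mE -mulrA.
    move: sy; apply: (@sspan_sub _ _ s [set y | exists c : 'rV[k]_q,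
        y = \sum_(j < q) c ord0 j *: s`_j]).
      apply/submoduleP; split.
        by exists 0; rewrite big1 // => j _; rewrite mxE scale0r.
      move=> d _ _ [c ->] [c' ->]; exists (d *: c + c').
      rewrite scaler_sumr -big_split; apply: eq_bigr => j _.
      by rewrite !mxE scalerDl scalerA.
    move=> x xs; have ltx : (index x s < q)%N by rewrite index_mem.
    exists (delta_mx ord0 (Ordinal ltx)).
    rewrite (bigD1 (Ordinal ltx)) //= mxE !eqxx scale1r nth_index // big1 ?addr0 //.
    by move=> j jx; rewrite mxE (negbTE jx) scale0r.
  by exists (\matrix_i c i) => i; under eq_bigr => j _ do rewrite mxE; apply: cE.
have relU v : F v -> Rel v 0 -> U v.
  move=> Fv R0; apply: contrapT => nUv; apply: ne => w Fw.
  have [a Ua] := covers_line cov Fv nUv Fw.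
  rewrite -[w](subrK (a * v)) mulrDr; apply: (submoduleD sU).
    exact: (left_idealM lU).
  rewrite mulrA; apply: (msgen [set x | U (x * v)]); last by exists a.
    split; first by rewrite /= mul0r; case: lU.
    by move=> b x y /= Ux Uy; rewrite mulrDl -mulrA; case: lU => _; apply.
  move=> x xms; have ltx : (index x ms < p)%N by rewrite index_mem.
  have := R0 (Ordinal ltx); rewrite /= nth_index // big1 ?subr0 // => j _.
  by rewrite mxE scale0r.
have fgM : fg_module 'M[k]_(p, q).
  apply/fg_moduleP; exists [seq delta_mx i j | i <- enum 'I_p, j <- enum 'I_q] => C.
  rewrite [C]matrix_sum_delta.
  apply: submodule_sum => [|i]; first exact: submodule_sspan.
  apply: submodule_sum => [|j]; first exact: submodule_sspan.
  apply: submoduleZ; first exact: submodule_sspan.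
  apply: mem_sspan.
  by apply/allpairsP; exists (i, j); rewrite !mem_enum.
have [|Cs CsE] := stationary_fg (fg_module_stationary fgM kacc)
    (U := [set C | exists2 v, F v & Rel v C]).
  apply/submoduleP; split.
    exists 0; first by case: lF.
    move=> i; rewrite mulr0 big1 ?subr0; first by case: lU.
    by move=> j _; rewrite mxE scale0r.
  move=> c C C' [v Fv RC] [w Fw RC']; exists (c *: v + w); last exact: relD.
  have sF := left_ideal_submodule lF.
  by apply: (submoduleD sF) => //; apply: (submoduleZ sF).
have /choice[vs vsE] : forall C, exists v, C \in Cs -> F v /\ Rel v C.
  move=> C; have [CCs|nC] := boolP (C \in Cs); last by exists 0.
  have : sspan Cs C by apply: mem_sspan.
  by rewrite -CsE => -[v Fv RC]; exists v.
exists (map vs Cs) => w Fw.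
have ss := submodule_sspan (map vs Cs).
have sF := left_ideal_submodule lF.
have [C RC] := relE w Fw.
suff [y [sy Fy Ry]] : exists y, [/\ sspan (map vs Cs) y, F y & Rel y C].
  exists y => //; apply: relU; first exact: (submoduleB sF).
  have := relD (- 1) _ _ _ _ Ry RC.
  by rewrite !scaleN1r addNr addrC.
have : sspan Cs C by rewrite -CsE; exists w.
apply: (@sspan_sub _ _ Cs [set C | exists y, [/\ sspan (map vs Cs) y, F y & Rel y C]]).
  apply/submoduleP; split.
    exists 0; split; [exact: submodule0|by case: lF|].
    move=> i; rewrite mulr0 big1 ?subr0; first by case: lU.
    by move=> j _; rewrite mxE scale0r.
  move=> c C1 C2 [y [sy Fy Ry]] [z [sz Fz Rz]]; exists (c *: y + z); split.
  - by apply: (submoduleD ss) => //; apply: (submoduleZ ss).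
  - by apply: (submoduleD sF) => //; apply: (submoduleZ sF).
  - exact: relD.
move=> C0 CCs; have [Fv Rv] := vsE _ CCs; exists (vs C0); split=> //.
by apply/mem_sspan/map_f.
Qed.

End SimpleFactor.

(** All simple factors of [A] being finitely generated over [k], so is [A], and
    the supports of finitely many generators exhaust the basis. *)
Lemma multiplicative_basis_finite : finite_set B.
Proof.
have [s sT] : exists s : seq A, [set: A] `<=` sspan s.
  apply: (@finite_length_ind (set A) (@left_ideal k A) (@nested true A) [set 0] setT
    (fun U => exists s, U `<=` sspan s) acc dcc).
  - exact: left_ideal0.
  - exact: left_idealT.
  - by move=> U _ u.
  - by exists [::] => _ ->; apply: (submodule0 (submodule_sspan _)).
  move=> U F cov [s Us]; have [t tF] := simple_factor_fg cov.
  exists (s ++ t) => w /tF[y ty Uy]; rewrite -[w](subrK y).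
  apply: (submoduleD (submodule_sspan _)).
    by apply: sspanS (Us _ Uy) => x xs; rewrite mem_cat xs.
  by apply: sspanS ty => x xs; rewrite mem_cat xs orbT.
have [r rB sr] := basis_seqs s.
apply: (sub_finite_set (B := [set` r])); last exact: finite_seq.
move=> t Bt /=; apply: (coord_sspan rB (a := t)); first exact/sr/sT.
by rewrite coord1 // oner_neq0.
Qed.

End MultiplicativeBasis.

(** * Subrepresentations generated at one object *)

Section Generation.
Context (k : comNzRingType) (D : smallCategory) (V : representation k D).

Definition sub_le (W W' : forall x, set (V x)) : Prop :=
  forall x, W x `<=` W' x.

Lemma rep_accE : rep_acc V -> stationary (@subrepresentation k D V) sub_le.
Proof.
move=> acc W sW chW; have [N WN] := acc W sW chW; exists N => n /WN E.
exact: functional_extensionality_dep.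
Qed.

Lemma rep_dccE : rep_dcc V ->
  stationary (@subrepresentation k D V) (fun W W' => sub_le W' W).
Proof.
move=> dcc W sW chW; have [N WN] := dcc W sW chW; exists N => n /WN E.
exact: functional_extensionality_dep.
Qed.

Lemma subrep_submodule (W : forall x, set (V x)) x :
  subrepresentation W -> submodule (V x) (W x).
Proof. by move=> [sW _]; apply: sW. Qed.

Definition gen_at (x : D) (X : set (V x)) (z : D) : set (V z) :=
  lin_span [set w | exists2 f : Mor x z, True & exists2 v, X v & w = rep_map V f v].

Arguments gen_at {x} X z _.

Lemma subrep_gen_at x (X : set (V x)) : subrepresentation (gen_at X).
Proof.
split=> [z|y z f v]; first exact: lin_span_submod.
apply: (@lin_span_sub _ _ _ [set v | gen_at X z (rep_map V f v)]).
  apply/submoduleP; split.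
    rewrite /= linear0; exact: (submodule0 (submodule_span _)).
  move=> c u w /= Gu Gw; rewrite linearP; have sG := submodule_span
    [set w | exists2 f : Mor x z, True & exists2 v, X v & w = rep_map V f v].
  by apply: (submoduleD sG) => //; apply: (submoduleZ sG).
move=> _ [g _ [w Xw ->]]; apply: sub_lin_span.
by exists (compm f g) => //; exists w => //; rewrite rep_map_comp.
Qed.

Lemma sub_gen_at x (X : set (V x)) : X `<=` gen_at X x.
Proof.
move=> v Xv; apply: sub_lin_span; exists (idm x) => //; exists v => //.
by rewrite rep_map_id.
Qed.

Lemma gen_at_min x (X : set (V x)) (W : forall z, set (V z)) :
  subrepresentation W -> X `<=` @W x -> sub_le (gen_at X) W.
Proof.
move=> [sW mW] XW z; apply: lin_span_sub; first exact: sW.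
by move=> _ [f _ [v Xv ->]]; apply/mW/XW.
Qed.

Lemma gen_atS x (X Y : set (V x)) : X `<=` Y -> sub_le (gen_at X) (gen_at Y).
Proof.
move=> XY; apply: gen_at_min; first exact: subrep_gen_at.
by move=> v /XY; apply: sub_gen_at.
Qed.

(** Through this the chain conditions of a representation pass to the modules
    over the endomorphisms of [x] that are its values. *)
Lemma gen_at_stable x (X : set (V x)) : submodule (V x) X ->
  (forall f v, X v -> X (rep_map V f v)) -> gen_at X x = X.
Proof.
move=> sX fX; apply/seteqP; split; last exact: sub_gen_at.
by apply: lin_span_sub => // _ [f _ [v Xv ->]]; apply: fX.
Qed.

End Generation.

Arguments gen_at {k D V x} X z _.

(** * Endomorphism algebras *)

Section EndAlgebra.
Context (k : comNzRingType) (D : smallCategory) (x : D).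

(** An alias of the free module, to carry the product induced by composition. *)
Definition endalg : Type := free_mod k (Mor x x).

HB.instance Definition _ := GRing.Lmodule.copy endalg (free_mod k (Mor x x)).

Implicit Types a b c : endalg.

Definition endone : endalg := fbase (idm x).
Definition endmul a b : endalg := lact (V := representable k x) a b.

Lemma endmulA : associative endmul.
Proof. by move=> a b c; rewrite /endmul lact_comp. Qed.

Lemma endmul1l : left_id endone endmul.
Proof. by move=> a; apply: (@lact_id k D (representable k x)). Qed.

Lemma endmul1r : right_id endone endmul.
Proof.
move=> a; rewrite /endmul; move: a; apply: free_mod_ind => [|f].
  apply/submoduleP; split; first by rewrite /= lact0l.
  by move=> c a b /= Ea Eb; rewrite lactDl lactZl Ea Eb.
by rewrite /= lact_base representable_base compm_idr.
Qed.

Lemma endmulDl : left_distributive endmul +%R.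
Proof. by move=> a b c; apply: (@lactDl k D (representable k x)). Qed.

Lemma endmulDr : right_distributive endmul +%R.
Proof. by move=> a b c; apply: (linearD (@lact k D (representable k x) x x a)). Qed.

Lemma endone_neq0 : endone != 0.
Proof.
apply/eqP => E; have := fcoef_base1 k (idm x).
rewrite (E : fbase (idm x) = 0) linear0 => /eqP.
by rewrite eq_sym oner_eq0.
Qed.

HB.instance Definition _ := GRing.Zmodule_isNzRing.Build endalg
  endmulA endmul1l endmul1r endmulDl endmulDr endone_neq0.

Lemma endscaleAl (c : k) a b : c *: (a * b) = (c *: a) * b.
Proof. by rewrite /GRing.mul /= /endmul lactZl. Qed.

HB.instance Definition _ := GRing.Lmodule_isLalgebra.Build k endalg endscaleAl.

Lemma endscaleAr (c : k) a b : c *: (a * b) = a * (c *: b).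
Proof. by rewrite /GRing.mul /= /endmul linearZ. Qed.

HB.instance Definition _ := GRing.Lalgebra_isAlgebra.Build k endalg endscaleAr.

Lemma lact_mul (V : representation k D) a b (v : V x) :
  lact (a * b) v = lact a (lact b v).
Proof. exact: lact_comp. Qed.

Lemma fbase_mul (f g : Mor x x) :
  (fbase f : endalg) * fbase g = fbase (compm f g).
Proof. by rewrite /GRing.mul /= /endmul lact_base representable_base. Qed.

Lemma left_ideal_gen_at (U : set endalg) : left_ideal U ->
  gen_at (V := representable k x) U x = U.
Proof.
move=> lU; have sU := left_ideal_submodule lU.
apply: gen_at_stable => // f v Uv.
by rewrite -lact_base; apply: (left_idealM lU).
Qed.

Lemma left_ideal_acc : rep_acc (representable k x) ->
  stationary (@left_ideal k endalg) (@nested true _).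
Proof.
move=> /rep_accE acc W lW chW.
have [n|n|N WN] := acc (fun n => gen_at (V := representable k x) (W n)).
- exact: subrep_gen_at.
- exact/gen_atS/chW.
- by exists N => n /WN E; rewrite -(left_ideal_gen_at (lW n)) E left_ideal_gen_at.
Qed.

Lemma left_ideal_dcc : rep_dcc (representable k x) ->
  stationary (@left_ideal k endalg) (@nested false _).
Proof.
move=> /rep_dccE dcc W lW chW.
have [n|n|N WN] := dcc (fun n => gen_at (V := representable k x) (W n)).
- exact: subrep_gen_at.
- exact/gen_atS/chW.
- by exists N => n /WN E; rewrite -(left_ideal_gen_at (lW n)) E left_ideal_gen_at.
Qed.

End EndAlgebra.

(** * Hom-sets and the ground ring of a category of dimension zero *)

Section DimensionZero.
Context (k : comNzRingType) (D : smallCategory).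
Hypothesis dim0 : dimension_zero k D.

Let acc (d : D) : rep_acc (representable k d).
Proof. by have [] := dim0 (representable_fg k d). Qed.

Let dcc (d : D) : rep_dcc (representable k d).
Proof. by have [] := dim0 (representable_fg k d). Qed.

Section GroundRing.
Variable d : D.

(** [I P_d] for an ideal [I] of [k]. *)
Definition ideal_rep (I : set k^o) (x : D) : set (representable k d x) :=
  lin_span [set w : representable k d x | exists2 c : k^o, I c & exists v, w = c *: v].

Arguments ideal_rep I x _ : clear implicits.

Lemma ideal_rep_subrep I : subrepresentation (ideal_rep I).
Proof.
split=> [x|x y f v]; first exact: lin_span_submod.
apply: (@lin_span_sub _ _ _ [set v | ideal_rep I y (rep_map (representable k d) f v)]).
  have sI : submodule (representable k d y) (ideal_rep I y) by apply: submodule_span.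
  apply/submoduleP; split.
    rewrite /= linear0; exact: (submodule0 sI).
  move=> c u w /= Gu Gw; rewrite linearP.
  by apply: (submoduleD sI) => //; apply: (submoduleZ sI).
move=> _ [c Ic [w ->]]; rewrite /= linearZ; apply: sub_lin_span.
by exists c => //; exists (rep_map (representable k d) f w).
Qed.

Lemma ideal_repS I J : I `<=` J -> sub_le (ideal_rep I) (ideal_rep J).
Proof. by move=> IJ x; apply: lin_spanS => v [c /IJ Jc vE]; exists c. Qed.

(** The coefficients of the elements of [I P_d] are in [I], so that [I] can be
    read off from the multiples of the identity of [d]. *)
Lemma ideal_rep_coef I : submodule k^o I ->
  I = [set c | ideal_rep I d (c *: (fbase (idm d) : representable k d d))].
Proof.
move=> sI; apply/seteqP; split=> c.
  by move=> Ic; apply: sub_lin_span; exists c => //; exists (fbase (idm d)).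
move=> /= Ic; have : I (fcoef (idm d) (c *: (fbase (idm d) : free_mod k (Mor d d)))).
  apply: (@lin_span_sub _ _ _ [set v : free_mod k (Mor d d) | I (fcoef (idm d) v)]) Ic.
    apply/submoduleP; split; first by rewrite /= linear0; apply: submodule0.
    move=> e u w /= Gu Gw; rewrite linearP.
    by apply: (submoduleD sI) => //; apply: (submoduleZ sI).
  move=> _ [e Ie [v ->]]; rewrite /mkset.
  suff -> : fcoef (idm d) (e *: v) = (fcoef (idm d) v : k) *: e.
    exact: (submoduleZ sI).
  by rewrite linearZ; apply: mulrC.
suff -> : fcoef (idm d) (c *: (fbase (idm d) : free_mod k (Mor d d))) = c by [].
by rewrite linearZ fcoef_base1; apply: mulr1.
Qed.

Lemma ground_ring_acc : stationary (submodule k^o) (@nested true _).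
Proof.
move=> I sI chI; have [n|n|N IN] := rep_accE (@acc d) (W := fun n => ideal_rep (I n)).
- exact: ideal_rep_subrep.
- exact/ideal_repS/chI.
- by exists N => n /IN E; rewrite (ideal_rep_coef (sI n)) E -(ideal_rep_coef (sI N)).
Qed.

Lemma ground_ring_artinian : artinian_ring k.
Proof.
move=> I sI chI; have [n|n|N IN] := rep_dccE (@dcc d) (W := fun n => ideal_rep (I n)).
- exact: ideal_rep_subrep.
- exact/ideal_repS/chI.
- by exists N => n /IN E; rewrite (ideal_rep_coef (sI n)) E -(ideal_rep_coef (sI N)).
Qed.

End GroundRing.

Lemma end_finite (x : D) : finite_set [set: Mor x x].
Proof.
have finB : finite_set (range (fun f : Mor x x => fbase f : endalg k x)).
  apply: multiplicative_basis_finite.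
  - by exists (idm x).
  - by move=> _ _ [f _ <-] [g _ <-]; exists (compm f g) => //; rewrite fbase_mul.
  - exact: free_mod_span.
  - move=> f; exists (@flift k (Mor x x) k^o (fun t => f (fbase t))) => _ [t _ <-].
    exact: (flift_base (M := k^o)).
  - exact: (ground_ring_acc x).
  - exact: (left_ideal_acc (@acc x)).
  - exact: (left_ideal_dcc (@dcc x)).
by rewrite -(eq_finite_set (inj_card_eq (fun f g _ _ => @fbase_inj k _ f g))).
Qed.

(** By the ascending chain condition finitely many morphisms generate [P_d x]
    under [Mor x x]; a basis element spanned by others is one of them. *)
Lemma hom_finite (d x : D) : finite_set [set: Mor d x].
Proof.
pose X (r : seq {classic Mor d x}) : set (representable k d x) :=
  [set fbase (f : Mor d x) | f in [set` r]].
have [||_ [r ->] maxr] := stationary_maximal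
  (Q := [set W | exists r, W = gen_at (X r)]) (rep_accE (@acc d)).
- by move=> _ [r ->]; apply: subrep_gen_at.
- by exists (gen_at (X [::])), [::].
have cover : [set: Mor d x] `<=`
    \bigcup_(g in [set` r]) range (fun h : Mor x x => compm h (g : Mor d x)).
  move=> f _.
  have : gen_at (X (f :: r)) x (fbase f).
    by apply: sub_gen_at; exists f => //=; rewrite inE eqxx.
  rewrite (maxr (gen_at (X (f :: r)))); first last.
  - by apply: gen_atS => _ [g gr <-]; exists g => //=; rewrite inE gr orbT.
  - by exists (f :: r).
  move=> span; apply: (@free_mod_mem k _ (fun f => (\bigcup_(g in [set` r])
    range (fun h : Mor x x => compm h (g : Mor d x))) f)).
  apply: lin_spanS span => _ [h _ [_ [g gr <-] ->]].
  exists (compm h g); first by exists g => //; exists h.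
  by rewrite representable_base.
apply: (sub_finite_set cover); apply: bigcup_finite; first exact: finite_seq.
by move=> g _; apply: finite_image; apply: end_finite.
Qed.

End DimensionZero.

(** * Endomorphisms factoring through another object *)

Section FactorSpan.
Context (k : comNzRingType) (D : smallCategory).

(** The ideal of the endomorphisms of [x] that factor through [y]. *)
Definition fact_span (x y : D) : set (endalg k x) :=
  lin_span [set (fbase s : endalg k x) | s in factors_through x y].

Arguments fact_span x y _ : clear implicits.

Lemma fact_span_submodule x y : submodule (endalg k x) (fact_span x y).
Proof. exact: submodule_span. Qed.

Lemma fact_span_mull x y a b : fact_span x y b -> fact_span x y (a * b).
Proof.
have sub := fact_span_submodule x y; move=> fb; move: a.
apply: (free_mod_ind (U := [set a : endalg k x | fact_span x y (a * b)])) => [|m].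
  apply/submoduleP; split; first by rewrite /= mul0r; apply: submodule0.
  move=> c a a' /= Fa Fa'; rewrite mulrDl -scalerAl.
  by apply: (submoduleD sub) => //; apply: (submoduleZ sub).
apply: (lin_span_sub (B := [set b | fact_span x y ((fbase m : endalg k x) * b)])) fb.
  apply/submoduleP; split; first by rewrite /= mulr0; apply: submodule0.
  move=> c b1 b2 /= Fb1 Fb2; rewrite mulrDr -scalerAr.
  by apply: (submoduleD sub) => //; apply: (submoduleZ sub).
move=> _ [_ [p [q ->]] <-]; rewrite /mkset fbase_mul; apply: sub_lin_span.
by eexists => //; exists p, (compm m q); rewrite compm_assoc.
Qed.

Lemma fact_span_lact x y (V : representation k D) (W W' : forall x, set (V x)) a u :
  subrepresentation W -> subrepresentation W' -> W' y `<=` W y ->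
  fact_span x y a -> W' x u -> W x (lact a u).
Proof.
move=> sW sW' WW fa Wu; have sWx := subrep_submodule x sW.
apply: (lin_span_sub (B := [set a : endalg k x | W x (lact a u)])) fa.
  apply/submoduleP; split; first by rewrite /= lact0l; apply: (submodule0 sWx).
  move=> c a1 a2 /= Wa1 Wa2; rewrite lactDl lactZl.
  by apply: (submoduleD sWx) => //; apply: (submoduleZ sWx).
move=> _ [_ [p [q ->]] <-]; rewrite /mkset lact_base rep_map_comp.
by apply: (proj2 sW); apply: WW; apply: (proj2 sW').
Qed.

(** The matrices of the definition are those of the action on [P_d x]. *)
Lemma le_atP (d x y : D) : le_at k d x y <->
  exists2 a, fact_span x y a & forall f : Mor d x,
    lact (V := representable k d) a (fbase f) = fbase f.
Proof.
pose mx (a : endalg k x) : hom_matrix k d x :=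
  fun f g => fcoef g (lact (V := representable k d) a (fbase f)).
have mxP c a b : mx (c *: a + b) = c *: mx a + mx b.
  apply/funext => f; apply/funext => g; rewrite /mx lactDl lactZl.
  exact: linearP.
have mx0 : mx 0 = 0.
  by apply/funext => f; apply/funext => g; rewrite /mx lact0l linear0.
have mx_base s : mx (fbase s) = postcomp_matrix k d x s.
  apply/funext => f; apply/funext => g.
  by rewrite /mx lact_base representable_base fcoef_base.
split=> [le|[a fa aid]].
  suff [a fa aE] : exists2 a, fact_span x y a & mx a = hom_matrix1 k d x.
    exists a => // f; apply: free_modP => g.
    have -> : fcoef g (lact (V := representable k d) a (fbase f)) = mx a f g by [].
    by rewrite aE fcoef_base.
  have sub := fact_span_submodule x y.
  apply: (lin_span_sub (B := [set M | exists2 a, fact_span x y a & mx a = M])) le.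
    apply/submoduleP; split; first by exists 0; [exact: submodule0|].
    move=> c _ _ [a fa <-] [b fb <-]; exists (c *: a + b); last exact: mxP.
    by apply: (submoduleD sub) => //; apply: (submoduleZ sub).
  move=> _ [s fs <-]; exists (fbase s); last exact: mx_base.
  by apply: sub_lin_span; exists s.
have mxa : mx a = hom_matrix1 k d x.
  apply/funext => f; apply/funext => g.
  by rewrite /mx aid fcoef_base.
rewrite /le_at -mxa.
have sub := submodule_span [set postcomp_matrix k d x s | s in factors_through x y].
apply: (lin_span_sub (B := [set a | lin_span _ (mx a)])) fa.
  apply/submoduleP; split; first by rewrite /= mx0; apply: (submodule0 sub).
  move=> c a1 a2 /= Fa1 Fa2; rewrite mxP.
  by apply: (submoduleD sub) => //; apply: (submoduleZ sub).
by move=> _ [s fs <-]; rewrite /mkset mx_base; apply: sub_lin_span; exists s.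
Qed.

End FactorSpan.

Arguments fact_span {k D} x y _.
Arguments fact_span_submodule {k D} x y.

(** * Existence of a homological modulus *)

Section ModulusExists.
Context (k : comNzRingType) (D : smallCategory) (V : representation k D).

(** A nonzero vector generates a simple representation; compare [covers_line]. *)
Lemma subrep_covers_gen (U F : forall x, set (V x)) x (u : V x) :
  covers (@subrepresentation k D V) (@sub_le k D V) U F ->
  F x u -> ~ U x u -> forall z w, F z w ->
  exists a : free_mod k (Mor x z), U z (w - lact a u).
Proof.
move=> [sU sF UF _ cov] Fu nUu z w Fw.
pose G z := F z `&` [set w | exists a : free_mod k (Mor x z), U z (w - lact a u)].
have [|||E|E] := cov G.
- split=> [t|t t' f v].
    apply: submoduleI; first exact: subrep_submodule.
    have sUt := subrep_submodule t sU.
    apply/submoduleP; split.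
      by exists 0; rewrite lact0l subr0; apply: submodule0.
    move=> c v v' [a Ua] [b Ub]; exists (c *: a + b).
    have -> : c *: v + v' - lact (c *: a + b) u =
        c *: (v - lact a u) + (v' - lact b u).
      by rewrite lactDl lactZl scalerBr opprD addrACA.
    by apply: (submoduleD sUt) => //; apply: (submoduleZ sUt).
  move=> [Fv [a Ua]]; split; first exact: (proj2 sF).
  exists (lact (V := representable k x) (fbase f) a).
  by rewrite lact_comp lact_base -linearB; apply: (proj2 sU).
- move=> t v Uv; split; first exact: UF.
  by exists 0; rewrite lact0l subr0.
- by move=> t v [].
- case: nUu; rewrite -E; split=> //; exists (fbase (idm x)).
  rewrite lact_id subrr; exact: (submodule0 (subrep_submodule x sU)).
- by move: Fw; rewrite -E => -[].
Qed.

(** The colour of an object records at which simple factors of [F] it does not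
    vanish; the conclusion is what equality of colours is used for. *)
Definition colourable (F : forall x, set (V x)) : Prop :=
  exists (C : finType) (col : D -> C), forall x y, col x = col y ->
    forall u, F x u -> exists2 a, fact_span x y a & lact a u = u.

(** [c] is defined by [1 - c = (1 - b) (1 - a)]. *)
Lemma fact_span_fix2 x y (a b : endalg k x) (u : V x) :
  fact_span x y a -> fact_span x y b -> lact b (u - lact a u) = u - lact a u ->
  exists2 c, fact_span x y c &
    lact c u = u /\ forall v : V x, lact a v = v -> lact c v = v.
Proof.
move=> fa fb E; have sub := fact_span_submodule (k := k) x y.
exists (a + (b - b * a)).
  apply: (submoduleD sub) => //; apply: (submoduleB sub) => //.
  exact: fact_span_mull.
have cE v : lact (a + (b - b * a)) v = lact a v + lact b (v - lact a v).
  by rewrite lactDl lactBl lact_mul linearB.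
by split=> [|v av]; rewrite cE ?E ?av ?subrr ?linear0 ?addr0 // addrC subrK.
Qed.

Lemma colourable_top : finite_length V -> colourable (fun _ => setT).
Proof.
move=> [/rep_accE acc /rep_dccE dcc].
apply: (finite_length_ind (bot := fun x => [set 0]) acc dcc).
- split=> [x|x y f v ->]; last by rewrite /= linear0.
  by apply/submoduleP; split=> // c u v -> ->; rewrite scaler0 addr0.
- by split=> // x; apply: submoduleT.
- by move=> U _ x v.
- exists unit, (fun=> tt) => x y _ u ->; exists 0; last exact: lact0l.
  exact: (submodule0 (fact_span_submodule x y)).
move=> U F cov [C [col colP]]; have [sU sF UF _ _] := cov.
exists (prod C bool), (fun x => (col x, `[< U x = F x >])).
move=> x y [colxy eqxy] u Fu.
have [Uu|nUu] := pselect (U x u); first exact: colP colxy _ Uu.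
have nUFy : U y <> F y.
  move=> UFy; have : `[< U x = F x >] by rewrite eqxy; apply/asboolP.
  by move=> /asboolP UFx; apply: nUu; rewrite UFx.
(* As [F / U] does not vanish at [y], some [h : x -> y] does not kill [u], and
   [u] is recovered from its image modulo [U x]; what remains of [u] lies in
   [U x], where the induction hypothesis applies. *)
have [w Fw nUw] : exists2 w, F y w & ~ U y w.
  apply: contrapT => no; apply: nUFy; apply/seteqP; split; first exact: UF.
  by move=> w Fw; apply: contrapT => nUw; apply: no; exists w.
have [a Ua] := subrep_covers_gen cov Fu nUu Fw.
have sUx := subrep_submodule x sU; have sUy := subrep_submodule y sU.
have [h nUh] : exists h : Mor x y, ~ U y (rep_map V h u).
  apply: contrapT => no; apply: nUw; rewrite -[w](subrK (lact a u)).
  apply: (submoduleD sUy) => //; move: (a); apply: free_mod_ind => [|h].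
    apply/submoduleP; split; first by rewrite /= lact0l; apply: (submodule0 sUy).
    move=> c b b' /= Ub Ub'; rewrite lactDl lactZl.
    by apply: (submoduleD sUy) => //; apply: (submoduleZ sUy).
  by rewrite /= lact_base; apply: contrapT => nU; apply: no; exists h.
have [b Ub] := subrep_covers_gen cov ((proj2 sF) _ _ h _ Fu) nUh Fu.
have [a1 fa1 a1E] : exists2 a1, fact_span x y a1 & lact a1 u = lact b (rep_map V h u).
  have sub := fact_span_submodule (k := k) x y.
  move: (b); apply: free_mod_ind => [|g].
    apply/submoduleP; split.
      by exists 0; [exact: submodule0|rewrite !lact0l].
    move=> c b1 b2 [a1 fa1 E1] [a2 fa2 E2]; exists (c *: a1 + a2).
      by apply: (submoduleD sub) => //; apply: (submoduleZ sub).
    by rewrite !lactDl !lactZl E1 E2.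
  exists (fbase (compm g h)); last by rewrite !lact_base rep_map_comp.
  by apply: sub_lin_span; exists (compm g h) => //; exists h, g.
rewrite -a1E in Ub.
have [a2 fa2 a2E] := colP _ _ colxy _ Ub.
by have [c fc [cu _]] := fact_span_fix2 fa1 fa2 a2E; exists c.
Qed.

Lemma fact_span_fix_seq x y :
  (forall u : V x, exists2 a : endalg k x, fact_span x y a & lact a u = u) ->
  forall r : seq (V x), exists2 a : endalg k x,
    fact_span x y a & forall u, u \in r -> lact a u = u.
Proof.
move=> fix1; elim=> [|u r [a fa ar]].
  by exists 0 => //; apply: (submodule0 (fact_span_submodule x y)).
have [b fb bE] := fix1 (u - lact a u).
have [c fc [cu cfix]] := fact_span_fix2 fa fb bE.
by exists c => // v; rewrite inE => /orP[/eqP -> //|/ar/cfix].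
Qed.

End ModulusExists.

Lemma dimension_zero_modulus (k : comNzRingType) (D : smallCategory) :
  dimension_zero k D -> exists mu : D -> set D, homological_modulus k mu.
Proof.
move=> dim0.
have /choice[mu muP] : forall d : D, exists S : set D,
    finite_set S /\ forall x, exists2 y, S y & le_at k d x y.
  move=> d.
  have [C [col colP]] := colourable_top (dim0 _ (representable_fg k d)).
  have /choice[rep repP] : forall c : C, exists y, forall x, col x = c -> col y = c.
    move=> c; have [[x xc]|no] := pselect (exists x, col x = c).
      by exists x.
    by exists d => x xc; case: no; exists x.
  exists (range rep); split; first by apply: finite_image; apply: finite_finset.
  move=> x; exists (rep (col x)); first by exists (col x).
  have /finite_seqP[r rE] :
      finite_set [set (fbase f : representable k d x) | f in setT].
    by apply: finite_image; apply: (hom_finite dim0).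
  have [u|a fa ar] := @fact_span_fix_seq _ _ (representable k d) x (rep (col x)) _ r.
    by apply: colP => //; rewrite (repP _ x).
  apply/le_atP; exists a => // f; apply: ar.
  suff : [set` r] (fbase f) by [].
  by rewrite -rE; exists f.
by exists mu; split=> d; have [] := muP d.
Qed.

(** * Categories with a homological modulus have dimension zero *)

Section ModulusSufficient.
Context (k : comNzRingType) (D : smallCategory).
Hypothesis finD : forall x y : D, finite_set [set: Mor x y].
Context (V : representation k D) (l : nat) (d : 'I_l -> D) (v : forall i, V (d i)).
Hypothesis gen : forall x, lin_span [set w : V x | exists (i : 'I_l) (f : Mor (d i) x),
  w = rep_map V f (v i)] = setT.

Lemma fg_value x : fg_module (V x).
Proof.
apply/fg_moduleP.
have /finite_seqP[r rE] : finite_set [set w : V x | exists (i : 'I_l) (f : Mor (d i) x),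
    w = rep_map V f (v i)].
  have -> : [set w : V x | exists (i : 'I_l) (f : Mor (d i) x),
      w = rep_map V f (v i)] =
      \bigcup_(i in [set: 'I_l]) range (fun f : Mor (d i) x => rep_map V f (v i)).
    apply/seteqP; split=> [w [i [f ->]]|w [i _ [f _ <-]]]; last by exists i, f.
    by exists i => //; exists f.
  by apply: bigcup_finite => [|i _]; [exact: finite_finset|exact: finite_image].
by exists r => w; rewrite /sspan -rE gen.
Qed.

Lemma subrep_eq_of_le_at (W W' : forall x, set (V x)) x :
  subrepresentation W -> subrepresentation W' -> (forall z, W z `<=` W' z) ->
  (forall i, exists y, le_at k (d i) x y /\ W y = W' y) -> W x = W' x.
Proof.
move=> sW sW' WW' mod; apply/seteqP; split; first exact: WW'.
move=> u W'u.
(* [E j] is spanned by the images of the generators of index at least [j]: each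
   factor [1 - a_j] of the product removes one generator. *)
pose E (j : nat) : set (V x) := lin_span [set w | exists i : 'I_l, (j <= i)%N /\
  exists f : Mor (d i) x, w = rep_map V f (v i)].
have sE j : submodule (V x) (E j) by apply: submodule_span.
have sWx := subrep_submodule x sW; have sW'x := subrep_submodule x sW'.
have step j : (j <= l)%N -> exists w, [/\ W' x w, W x (u - w) & E j w].
  elim: j => [_|j IHj ltjl].
    exists u; split=> //; first by rewrite subrr; apply: (submodule0 sWx).
    have : setT u by []; rewrite -gen; apply: lin_spanS => w [i [f ->]].
    by exists i; split=> //; exists f.
  have [w [W'w Wuw Ew]] := IHj (ltnW ltjl).
  have [y [/le_atP[a fa aid] Wy]] := mod (Ordinal ltjl).
  have afix f :
      lact a (rep_map V f (v (Ordinal ltjl))) = rep_map V f (v (Ordinal ltjl)).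
    by rewrite -lact_base -lact_comp aid.
  have Waw : W x (lact a w).
    by apply: (fact_span_lact sW sW' _ fa W'w); rewrite Wy.
  exists (w - lact a w); split.
  - by apply: (submoduleB sW'x) => //; apply: WW'.
  - by rewrite opprB addrA addrAC addrC -[_ + (u - w)]addrC; apply: (submoduleD sWx).
  move: Ew; apply: (lin_span_sub (B := [set w | E j.+1 (w - lact a w)])).
    apply/submoduleP; split.
      by rewrite /= linear0 subr0; apply: (submodule0 (sE _)).
    move=> c w1 w2 /= E1 E2; rewrite linearP opprD addrACA -scalerBr.
    by apply: (submoduleD (sE _)) => //; apply: (submoduleZ (sE _)).
  move=> _ [i [leji [f ->]]]; rewrite /mkset.
  have [eqij|neij] := eqVneq (i : nat) j.
    have iE : i = Ordinal ltjl by apply: val_inj.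
    by subst i; rewrite afix subrr; apply: (submodule0 (sE _)).
  have ltji : (j < i)%N by rewrite ltn_neqAle eq_sym neij.
  apply: (submoduleB (sE _)).
    by apply: sub_lin_span; exists i; split=> //; exists f.
  rewrite -lact_base -lact_comp.
  move: (lact (V := representable k (d i)) a (fbase f)); apply: (free_mod_ind
    (U := [set b : free_mod k (Mor (d i) x) | E j.+1 (lact b (v i))])) => [|g].
    apply/submoduleP; split; first by rewrite /= lact0l; apply: (submodule0 (sE _)).
    move=> c b1 b2 /= E1 E2; rewrite lactDl lactZl.
    by apply: (submoduleD (sE _)) => //; apply: (submoduleZ (sE _)).
  by rewrite /= lact_base; apply: sub_lin_span; exists i; split=> //; exists g.
have [w [W'w Wuw Ew]] := step l (leqnn l).
suff w0 : w = 0 by move: Wuw; rewrite w0 subr0.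
apply: (lin_span_sub (B := [set 0])) Ew.
  by apply/submoduleP; split=> // c a b -> ->; rewrite scaler0 addr0.
by move=> w0 [i [leli _]]; move: (ltn_ord i); rewrite ltnNge leli.
Qed.

End ModulusSufficient.

Lemma stationary_all (I : eqType) (r : seq I) (P : I -> nat -> Prop) :
  (forall i, i \in r -> exists N, forall n, (N <= n)%N -> P i n) ->
  exists N, forall i, i \in r -> forall n, (N <= n)%N -> P i n.
Proof.
elim: r => [|i r IHr] H; first by exists 0%N.
have [|N1 H1] := IHr; first by move=> j jr; apply: H; rewrite inE jr orbT.
have [|N2 H2] := H i; first by rewrite inE eqxx.
exists (maxn N1 N2) => j; rewrite inE => /orP[/eqP ->|jr] n;
  rewrite geq_max => /andP[le1 le2]; [exact: H2|exact: H1].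
Qed.

Lemma modulus_stationary (k : comNzRingType) (D : smallCategory) (mu : D -> set D)
    (V : representation k D) (up : bool) :
  (forall x y : D, finite_set [set: Mor x y]) -> homological_modulus k mu ->
  finitely_generated V -> stationary (submodule k^o) (@nested up _) ->
  forall W : nat -> forall x, set (V x), (forall n, subrepresentation (W n)) ->
    (forall n x, nested up (W n x) (W n.+1 x)) ->
    exists N, forall n, (N <= n)%N -> forall x, W n x = W N x.
Proof.
move=> finD [mufin muP] [l [d [v gen]]] stk W sW chW.
have /finite_seqP[r rE] :
    finite_set (\bigcup_(i in [set: 'I_l]) mu (d i) : set {classic D}).
  by apply: bigcup_finite => [|i _]; [exact: finite_finset|exact: mufin].
have [y yr|N WN] := @stationary_all _ r
  (fun y n => forall m, (n <= m)%N -> W m y = W n y).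
  have [n|n|N WN] := fg_module_stationary (fg_value finD gen y) stk
    (W := fun n => W n y).
  - exact: (subrep_submodule _ (sW n)).
  - exact: chW.
  - by exists N => n leNn m lenm; rewrite (WN m) ?(WN n) // (leq_trans leNn).
exists N => n leNn x.
have eqr i : exists y, le_at k (d i) x y /\ W n y = W N y.
  have [y muy le] := muP (d i) x; exists y; split=> //.
  apply: WN => //; suff : [set` r] (y : {classic D}) by [].
  by rewrite -rE; exists i.
move: (fun z => nested_le (fun i => chW i z) leNn); rewrite /nested; case: (up) => WW.
  apply/esym; apply: (subrep_eq_of_le_at gen (sW N) (sW n) WW) => i.
  by have [y [le E]] := eqr i; exists y.
by apply: (subrep_eq_of_le_at gen (sW n) (sW N) WW).
Qed.

Theorem theorem1p5 (k : comNzRingType) (D : smallCategory)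
    (D_nonempty : inhabited D) :
  dimension_zero k D <->
    [/\ artinian_ring k,
        (forall x y : D, finite_set [set: Mor x y]%classic) &
        (exists mu : D -> set D, homological_modulus k mu)].
Proof.
split=> [dim0|[art finD [mu muP]] V fgV].
  have [d] := D_nonempty.
  split; [exact: ground_ring_artinian d|exact: (hom_finite dim0)|].
  exact: dimension_zero_modulus.
have dcc : stationary (submodule k^o) (@nested false _) by exact: art.
have acc := artinian_noetherian dcc.
by split=> W sW chW; [exact: (modulus_stationary finD muP fgV acc)|
  exact: (modulus_stationary finD muP fgV dcc)].
Qed.
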